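(* Let $0\le k\le n-1$ and $\mathbf{m}=(1,\dots,1,n-k)\in\mathbb{N}^{k+1}$. For $\mathbf{b}=(b_1,\dots,b_n)\in\mathbb{N}^n$ and $1\le i\le n-1$, let $\beta_{i-1,\mathbf{b}}(\mathcal{M}_{K_{n+1}}^{(k)})$ be the $(i-1)$-th multigraded Betti number of the $k$-skeleton ideal $\mathcal{M}_{K_{n+1}}^{(k)}$ in degree $\mathbf{b}$. Then the following hold. (i) For $J=\{j_1,\dots,j_t\}\in\mathcal{I}_{\mathbf{m}}^{*,1}\langle i-1\rangle$, $\beta_{i-1,\mathbf{b}(J)}(\mathcal{M}_{K_{n+1}}^{(k)})=1$, where $t=i$. (ii) For $J=\{j_1,\dots,j_t\}\in\mathcal{I}_{\mathbf{m}}^{*,2}\langle i-1\rangle$, $\beta_{i-1,\mathbf{b}(J)}(\mathcal{M}_{K_{n+1}}^{(k)})=\binom{j_t-j_{t-1}-1}{k-j_{t-1}}$, where $t+j_t-k=i$. (iii) If $\mathbf{b}=\pi\mathbf{b}(J)$ is a permutation of $\mathbf{b}(J)$ for some $J\in\mathcal{I}_{\mathbf{m}}^{*}\langle i-1\rangle$ and some permutation $\pi$ of $[n]$, then $\beta_{i-1,\mathbf{b}}(\mathcal{M}_{K_{n+1}}^{(k)})=\beta_{i-1,\mathbf{b}(J)}(\mathcal{M}_{K_{n+1}}^{(k)})$. Otherwise, $\beta_{i-1,\mathbf{b}}(\mathcal{M}_{K_{n+1}}^{(k)})=0$. (iv) The $(i-1)$-th Betti number of $\mathcal{M}_{K_{n+1}}^{(k)}$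 is \[ \beta_{i-1}(\mathcal{M}_{K_{n+1}}^{(k)})=\beta_i\!\left(\frac{R}{\mathcal{M}_{K_{n+1}}^{(k)}}\right)=\sum_{J\in\mathcal{I}_{\mathbf{m}}^{*,1}\langle i-1\rangle}\beta_{i-1}^{J}+\sum_{\tilde J\in\mathcal{I}_{\mathbf{m}}^{*,2}\langle i-1\rangle}\beta_{i-1}^{\tilde J}, \] where $\beta_{i-1}^{J}=\prod_{\alpha=1}^{i}\binom{j_{\alpha+1}}{j_\alpha}$ for $J=\{j_1,\dots,j_i\}\in\mathcal{I}_{\mathbf{m}}^{*,1}\langle i-1\rangle$ and $\beta_{i-1}^{\tilde J}=\left[\prod_{\alpha=1}^{t}\binom{l_{\alpha+1}}{l_\alpha}\right]\binom{l_t-l_{t-1}-1}{k-l_{t-1}}$ for $\tilde J=\{l_1,\dots,l_t\}\in\mathcal{I}_{\mathbf{m}}^{*,2}\langle i-1\rangle$. Here $j_{i+1}=l_{t+1}=n$.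
   Context: $\mathbb{N}=\{0,1,2,\dots\}$, $[n]=\{1,\dots,n\}$; $R=\mathbb{K}[x_1,\dots,x_n]$ over a field $\mathbb{K}$ with its $\mathbb{N}^n$-grading. The $k$-skeleton ideal of the complete graph $K_{n+1}$ on $\{0,1,\dots,n\}$ with root $0$ is \[ \mathcal{M}_{K_{n+1}}^{(k)}=\Big\langle \Big(\prod_{j\in A}x_j\Big)^{n-|A|+1}:\ \emptyset\ne A\subseteq[n],\ |A|\le k+1\Big\rangle\subseteq R. \] Betti numbers are those of the minimal (multigraded) free resolution over $R$. Dual $\mathbf{m}$-isolated subsets for $\mathbf{m}=(1,\dots,1,n-k)\in\mathbb{N}^{k+1}$: let $J=\{j_1,\dots,j_t\}\subseteq[n]$ be non-empty with $0=j_0<j_1<\cdots<j_t$ (elements are always listed increasingly, with $j_0=0$, and likewise $l_0=0$). (1) $J$ is dual $\mathbf{m}$-isolated of type-1 if $J\subseteq[k+1]$; its dual weight is $\mathrm{dwt}(J)=t-1$. (2) $J$ is dual $\mathbf{m}$-isolated of type-2 if $J\setminus\{j_t\}\subseteq[k]$ and $k+1<j_t\le n$; its dual weight is $\mathrm{dwt}(J)=(t-1)+(j_t-k)$. $\mathcal{I}_{\mathbf{m}}^{*,1}\langle i\rangle$ and $\mathcal{I}_{\mathbf{m}}^{*,2}\langle i\rangle$ denote the sets of dual $\mathbf{m}$-isolated subsets of type-1, respectively type-2, of dual weight $i$, and $\mathcal{I}_{\mathbf{m}}^{*}\langle i\rangle$ is their disjoint union. Degrees: set $\lambda_i=n-i+1$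 for $1\le i\le k$ and $\lambda_i=n-k$ for $k+1\le i\le n$. Let $e_1,\dots,e_n$ be the standard basis vectors of $\mathbb{R}^n$ and $\varepsilon(i,j)=\sum_{l=i+1}^{j}e_l$ for $0\le i<j\le n$. For a dual $\mathbf{m}$-isolated subset $J=\{j_1,\dots,j_t\}$, $\mathbf{b}(J)=\sum_{\alpha=1}^{t}\lambda_{j_\alpha}\,\varepsilon(j_{\alpha-1},j_\alpha)\in\mathbb{N}^n$.
   Formalization: The dual weight of a type-2 subset is taken as (t-1)+(j_t-(k+1)) instead of (t-1)+(j_t-k), so (ii) reads t+j_t-(k+1)=i; with the stated weight the claim fails, e.g. n=3, k=0, i=2, where β_1=3 but no subset has weight 1. *)

(* Defs.v *)
From HB Require Import structures.
From mathcomp Require Import all_boot all_fingroup all_order all_algebra.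
From mathcomp.multinomials Require Import mpoly.
From Stdlib Require Import ClassicalEpsilon.

Set Implicit Arguments.
Unset Strict Implicit.
Unset Printing Implicit Defensive.

Import GRing.Theory.
Local Open Scope ring_scope.

(* The index set [n] = {1, ..., n} is encoded by 'I_n throughout, the ordinal
   l standing for the integer l.+1; in particular 'X_l is the variable
   x_(l.+1). *)

Section MultigradedResolutions.

Variables (K : fieldType) (n : nat).

(* Data of a complex of finitely generated N^n-graded free modules
     ... -> F_2 -> F_1 -> F_0
   with an augmentation F_0 -> R, where R = K[x_1, ..., x_n]: F_i has a basis
   indexed by 'I_(rk i), the p-th basis vector having degree deg p.  Elements
   of F_i are row vectors, and the maps are v |-> v *m dif i and
   v |-> v *m aug. *)
Record mcomplex := MComplex {
  rk : nat -> nat;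
  deg : forall i : nat, 'I_(rk i) -> 'X_{1..n};
  dif : forall i : nat, 'M[{mpoly K[n]}]_(rk i.+1, rk i);
  aug : 'cV[{mpoly K[n]}]_(rk 0)
}.

(* Every map sends a basis vector to a homogeneous element of the same
   degree. *)
Definition multigraded (F : mcomplex) : Prop :=
  (forall (i : nat) (p : 'I_(rk F i.+1)) (q : 'I_(rk F i)) (m : 'X_{1..n}),
     m \in msupp (dif F i p q) -> deg p = (m + deg q)%MM) /\
  (forall (p : 'I_(rk F 0)) (m : 'X_{1..n}),
     m \in msupp (aug F p 0) -> m = deg p).

(* For ideals N <= L of R, F is a free resolution of the R-module L / N: the
   augmentation takes its values in L, it is onto modulo N, its kernel modulo N
   is the image of F_1, and the complex is exact at F_1, F_2, ... *)
Definition resolves (L N : {mpoly K[n]} -> Prop) (F : mcomplex) : Prop :=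
  [/\ forall p : 'I_(rk F 0), L (aug F p 0),
      forall f : {mpoly K[n]}, L f ->
        exists v : 'rV[{mpoly K[n]}]_(rk F 0), N (f - (v *m aug F) 0 0),
      forall v : 'rV[{mpoly K[n]}]_(rk F 0),
        N ((v *m aug F) 0 0) <->
        exists w : 'rV[{mpoly K[n]}]_(rk F 1), v = w *m dif F 0
    & forall (i : nat) (v : 'rV[{mpoly K[n]}]_(rk F i.+1)),
        v *m dif F i = 0 <->
        exists w : 'rV[{mpoly K[n]}]_(rk F i.+2), v = w *m dif F i.+1].

(* F_(i+1) is mapped into (x_1, ..., x_n) F_i. *)
Definition minimal (F : mcomplex) : Prop :=
  forall (i : nat) (p : 'I_(rk F i.+1)) (q : 'I_(rk F i)),
    (dif F i p q)@_0%MM = 0.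

Definition minimal_resolution (L N : {mpoly K[n]} -> Prop) (F : mcomplex) :=
  [/\ multigraded F, resolves L N F & minimal F].

Definition zero_mcomplex : mcomplex :=
  @MComplex (fun=> 0%N) (fun _ _ => 0%MM) (fun=> 0) 0.

(* The minimal multigraded free resolution of L / N, which is unique up to
   isomorphism. *)
Definition minres (L N : {mpoly K[n]} -> Prop) : mcomplex :=
  epsilon (inhabits zero_mcomplex) (minimal_resolution L N).

Definition mbetti_subquo (L N : {mpoly K[n]} -> Prop) (i : nat)
    (b : 'X_{1..n}) : nat :=
  #|[set p : 'I_(rk (minres L N) i) | deg p == b]|.

Definition betti_subquo (L N : {mpoly K[n]} -> Prop) (i : nat) : nat :=
  rk (minres L N) i.

Definition zero_ideal (f : {mpoly K[n]}) : Prop := f = 0.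
Definition unit_ideal (f : {mpoly K[n]}) : Prop := True.

Definition mbetti_ideal (I : {mpoly K[n]} -> Prop) := mbetti_subquo I zero_ideal.
Definition betti_ideal (I : {mpoly K[n]} -> Prop) := betti_subquo I zero_ideal.
Definition betti_quotient (I : {mpoly K[n]} -> Prop) := betti_subquo unit_ideal I.

Definition ideal_generated (T : finType) (P : pred T) (g : T -> {mpoly K[n]})
    (f : {mpoly K[n]}) : Prop :=
  exists c : T -> {mpoly K[n]}, f = \sum_(A | P A) c A * g A.

Definition skeleton_ideal (k : nat) : {mpoly K[n]} -> Prop :=
  ideal_generated (fun A : {set 'I_n} => (A != set0) && (#|A| <= k.+1)%N)
    (fun A => (\prod_(j in A) 'X_j) ^+ (n - #|A| + 1)).

End MultigradedResolutions.

Arguments zero_ideal {K n}.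
Arguments unit_ideal {K n}.

Section DualIsolated.

Local Open Scope nat_scope.

Variables (n k : nat).

(* For J = {j_1 < ... < j_t}, elt J a is j_a, with j_0 = 0 and j_(t+1) = n
   (enum lists ordinals in increasing order). *)
Definition elt (J : {set 'I_n}) (a : nat) : nat :=
  nth 0 (0 :: rcons [seq (val j).+1 | j <- enum J] n) a.

Definition dual_isolated1 (J : {set 'I_n}) : bool :=
  (J != set0) && [forall j in J, j.+1 <= k.+1].

Definition dual_isolated2 (J : {set 'I_n}) : bool :=
  [&& J != set0,
      [forall j in J, (j.+1 != elt J #|J|) ==> (j.+1 <= k)]
    & k.+1 < elt J #|J| <= n].

Definition dwt1 (J : {set 'I_n}) : nat := #|J| - 1.

(* The weight (t - 1) + (j_t - k) found in the source is off by one.  Take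
   k = 0: the ideal is the complete intersection (x_1^n, ..., x_n^n), whose
   first syzygies have degrees the permutations of b({2}) = (n, n, 0, ..., 0),
   so {2} has weight 1. *)
Definition dwt2 (J : {set 'I_n}) : nat := (#|J| - 1) + (elt J #|J| - (k + 1)).

Definition dual_iso1 (i : nat) : {set {set 'I_n}} :=
  [set J | dual_isolated1 J & dwt1 J == i].

Definition dual_iso2 (i : nat) : {set {set 'I_n}} :=
  [set J | dual_isolated2 J & dwt2 J == i].

Definition dual_iso (i : nat) : {set {set 'I_n}} := dual_iso1 i :|: dual_iso2 i.

Definition lam (i : nat) : nat := if i <= k then n - i + 1 else n - k.

Definition eps (i j : nat) : 'X_{1..n} :=
  (\sum_(l < n | i < l.+1 <= j) U_(l))%MM.

Definition bdeg (J : {set 'I_n}) : 'X_{1..n} :=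
  (\sum_(1 <= a < #|J|.+1) eps (elt J a.-1) (elt J a) *+ lam (elt J a))%MM.

Definition mnm_perm (s : 'S_n) (b : 'X_{1..n}) : 'X_{1..n} :=
  [multinom b (s l) | l < n].

Definition beta1 (J : {set 'I_n}) : nat :=
  \prod_(1 <= a < #|J|.+1) 'C(elt J a.+1, elt J a).

Definition beta2 (J : {set 'I_n}) : nat :=
  (\prod_(1 <= a < #|J|.+1) 'C(elt J a.+1, elt J a)) *
  'C(elt J #|J| - elt J (#|J| - 1) - 1, k - elt J (#|J| - 1)).

End DualIsolated.

(* Main.v *)
Require Import Defs.
From mathcomp Require Import all_boot all_fingroup all_order all_algebra.
From mathcomp.multinomials Require Import mpoly.
From mathcomp Require Import zify.
From Stdlib Require Import Classical ClassicalEpsilon.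

Set Implicit Arguments.
Unset Strict Implicit.
Unset Printing Implicit Defensive.

Import GRing.Theory.
Local Open Scope ring_scope.

(** A minimal multigraded resolution is determined by scalar matrices [D i],
the monomials being dictated by the degrees of the basis vectors; it is exact
if and only if, for every degree [c], the basis vectors of degree at most [c]
span an exact complex of vector spaces.  Fix a degree [b].  For disjoint sets
[A], [T] of variables in the support of [b], the basis vectors of degree at
most [b - T] whose degree agrees with [b] on [A] span a subquotient complex.
For [A] empty its homology is that of R/I in degree [b - T]; a variable is
added to [A] by a short exact sequence; for [A] the whole support minimality
makes the differential zero, so that the homology counts the basis vectors of
degree [b].  This replaces the Koszul complex of R/I, and yields the uniqueness
of the Betti numbers at the same time.

For the skeleton ideal, a monomial lies outside I if and only if, for every
[s] at most [k + 1], fewer than [s] exponents are at least [n + 1 - s].  The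
variables of exponent [n + 1 - s] in [b] therefore contribute independently,
each class like the pairs (simplex, skeleton), whose homology sits in a single
degree and has binomial dimension.  The product is non-zero exactly when [b] is
a permutation of some b(J).

A minimal resolution exists because the syzygies in degree [c] depend only on
the truncation of [c] to a finite box, so that an irredundant finite generating
family can be chosen at each step. *)

Lemma choice_function (A B : Type) (R : A -> B -> Prop) :
  (forall x, exists y, R x y) -> exists f : A -> B, forall x, R x (f x).
Proof.
move=> h; exists (fun x => sval (constructive_indefinite_description _ (h x))) => x.
exact: svalP (constructive_indefinite_description _ (h x)).
Qed.

(** * Rank inequalities behind the long exact sequence *)

Section RankInequalities.

Variables (K : fieldType) (m2 m1 m0 : nat).
Variables (B2 : 'M[K]_(m2, m1)) (B1 : 'M[K]_(m1, m0)) (N' N'' : 'M[K]_m1).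

(** [N''] is meant as the projection onto a quotient complex. The hypothesis puts the rows of
    [M' *m B2] into the part of the image of [B2] killed by [N''], which has dimension
    [\rank B2 - \rank (B2 *m N'')]. *)
Lemma rank_restrict_project (M' : 'M[K]_m2) :
  M' *m B2 *m N'' = 0 ->
  (\rank (M' *m B2) + \rank (B2 *m N'') <= \rank B2)%N.
Proof.
move=> h; rewrite -(mxrank_mul_ker B2 N'') addnC leq_add2l.
by apply/mxrankS; rewrite sub_capmx submxMl; apply/sub_kermxP.
Qed.

Hypotheses (B2N : B2 *m (N' + N'') = B2) (NB1 : (N' + N'') *m B1 = B1).
Hypothesis (B21 : B2 *m B1 = 0).

(** Boundaries of the whole complex that vanish in the quotient lie in the subcomplex and are cycles
    there; the inequality compares the dimensions of these two spaces. *)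
Lemma rank_sub_cycles :
  (\rank (N' *m B1) + \rank B2 <= \rank N' + \rank (B2 *m N''))%N.
Proof.
rewrite -(mxrank_mul_ker B2 N'') -(mxrank_mul_ker N' B1).
set U := (B2 :&: _)%MS.
suff: (\rank U <= \rank (N' :&: kermx B1)%MS)%N by lia.
have UN'' : U *m N'' = 0 by apply/sub_kermxP/capmxSr.
have [X UE] := submxP (capmxSl B2 (kermx N'')); rewrite -/U in UE.
have UN' : U *m N' = U.
  by rewrite [RHS]UE -B2N mulmxA -UE mulmxDr UN'' addr0.
apply/mxrankS; rewrite sub_capmx -{1}UN' submxMl /=.
by apply/sub_kermxP; rewrite UE -mulmxA B21 mulmx0.
Qed.

(** Modulo the boundaries [N' *m B1] of the subcomplex, a reduction performed by [X], the map [B1]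
    depends only on the quotient part, and the boundaries of the quotient lie in the kernel of the
    induced map. *)
Lemma rank_quotient_boundaries :
  (\rank (B2 *m N'') + \rank B1 <= \rank N'' + \rank (N' *m B1))%N.
Proof.
set X := cokermx (N' *m B1).
have AX : N' *m (B1 *m X) = 0 by rewrite mulmxA mulmx_coker.
have hB1 : (\rank B1 <= \rank (N' *m B1) + \rank (B1 *m X))%N.
  rewrite -(mxrank_mul_ker B1 X) addnC leq_add2r; apply/mxrankS.
  apply: submx_trans (capmxSr _ _) _.
  by rewrite submxE mulmx_ker.
have E : N'' *m (B1 *m X) = B1 *m X.
  by rewrite -[in RHS]NB1 -[RHS]mulmxA mulmxDl AX add0r.
have := mxrank_mul_ker N'' (B1 *m X); rewrite E => E2.
suff: (\rank (B2 *m N'') <= \rank (N'' :&: kermx (B1 *m X))%MS)%N by lia.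
apply/mxrankS; rewrite sub_capmx submxMl /=; apply/sub_kermxP.
by rewrite -mulmxA E mulmxA B21 mul0mx.
Qed.

End RankInequalities.

(** * Coordinate projections *)

Section Masks.

Variable K : fieldType.

Definition mask m (P : {set 'I_m}) : 'M[K]_m := diag_mx (\row_p (p \in P)%:R).

Lemma mask_mulE m r (P : {set 'I_m}) (A : 'M_(m, r)) p q :
  (mask P *m A) p q = (p \in P)%:R * A p q.
Proof. by rewrite mul_diag_mx !mxE. Qed.

Lemma mul_maskE m r (P : {set 'I_m}) (A : 'M_(r, m)) p q :
  (A *m mask P) p q = A p q * (q \in P)%:R.
Proof. by rewrite mul_mx_diag !mxE. Qed.

Lemma rank_mask m (P : {set 'I_m}) : \rank (mask P) = #|P|.
Proof.
(* [A] selects the rows indexed by [P]; it is row-free, and the mask factors as [A^T *m A]. *)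
pose A : 'M[K]_(#|P|, m) := rowsub (@enum_val _ (mem P)) 1%:M.
have AAt : A *m A^T = 1%:M.
  apply/matrixP => i j; rewrite !mxE (bigD1 (enum_val i)) //= !mxE eqxx mul1r.
  rewrite big1 ?addr0 => [|q /negPf qi]; last by rewrite !mxE eq_sym qi mul0r.
  by rewrite (inj_eq enum_val_inj) eq_sym.
have Afree : row_free A by apply/row_freeP; exists A^T.
suff -> : mask P = A^T *m A.
  by rewrite mxrankMfree // mxrank_tr; apply/eqP.
apply/matrixP => p q; rewrite !mxE.
under eq_bigr => i _ do rewrite !mxE.
have [Pp|nPp] := boolP (p \in P); last first.
  rewrite mul0rn big1 // => i _; have [E|_] := eqVneq (enum_val i) p.
    by have := enum_valP i; rewrite E (negPf nPp).
  by rewrite mul0r.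
rewrite (bigD1 (enum_rank_in Pp p)) //= enum_rankK_in // eqxx mul1r.
rewrite big1 ?addr0 // => i ne; case: eqP => [E|_]; last by rewrite mul0r.
by case/eqP: ne; apply: enum_val_inj; rewrite enum_rankK_in.
Qed.

End Masks.

(** * Homology of subquotients spanned by basis vectors *)

Section BasisSubsets.

Variables (K : fieldType) (rk : nat -> nat).
Variable D : forall i, 'M[K]_(rk i.+1, rk i).

Implicit Types S : forall i, {set 'I_(rk i)}.

(** The matrix keeps its size, entries outside [S] becoming zero, so that restrictions to different
    subsets can be added and multiplied without reindexing. *)
Definition restr S i : 'M[K]_(rk i.+1, rk i) :=
  \matrix_(p, q) (if (p \in S i.+1) && (q \in S i) then D i p q else 0).

(** The index is that of the source: the map leaving degree [i] has rank [brank S i], the map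
    entering it has rank [brank S i.+1]. *)
Definition brank S i : nat := if i is j.+1 then \rank (restr S j) else 0%N.

(* [f i] is the dimension of the i-th homology of the complex spanned by the
   basis vectors in S. *)
Definition hom_dim S (f : nat -> nat) :=
  forall i, #|S i| = (f i + brank S i.+1 + brank S i)%N.

Lemma eq_hom_dim S f g : f =1 g -> hom_dim S f -> hom_dim S g.
Proof. by move=> fg hS i; rewrite -fg. Qed.

Section LongExactSequence.

Variables S S' S'' : forall i, {set 'I_(rk i)}.
Hypothesis Spart : forall i p, (p \in S i) = (p \in S' i) || (p \in S'' i).
Hypothesis Sdisj : forall i p, p \in S' i -> p \notin S'' i.
Hypothesis Ssub : forall i p q, p \in S' i.+1 -> q \in S'' i -> D i p q = 0.
Hypothesis Scplx : forall i, restr S i.+1 *m restr S i = 0.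

Let N' i := mask K (S' i).
Let N'' i := mask K (S'' i).

Let card_split i : #|S i| = (#|S' i| + #|S'' i|)%N.
Proof.
rewrite -cardsUI; have -> : S' i :&: S'' i = set0.
  by apply/setP => p; rewrite !inE; apply/negP => /andP[/Sdisj/negP].
by rewrite cards0 addn0; apply: eq_card => p; rewrite inE Spart.
Qed.

Let restr_sub i : N' i.+1 *m restr S i = restr S' i.
Proof.
apply/matrixP => p q; rewrite mask_mulE !mxE !Spart.
have [S'p|] := boolP (p \in S' _); rewrite ?mul0r //= mul1r.
case: (boolP (q \in S' _)) => //= _; case: (boolP (q \in S'' _)) => // h.
by rewrite (Ssub S'p h).
Qed.

Let restr_quo i : restr S i *m N'' i = restr S'' i.
Proof.
apply/matrixP => p q; rewrite mul_maskE !mxE !Spart andbC.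
have [S''q|] := boolP (q \in S'' _); rewrite ?mulr0 ?andbF ?andbT //= mulr1 orbT /=.
have [S'p|] := boolP (p \in S' _) => //=.
by rewrite (Ssub S'p S''q); case: ifP.
Qed.

Let restr_mix i : N' i.+1 *m restr S i *m N'' i = 0.
Proof.
apply/matrixP => p q; rewrite restr_sub mul_maskE !mxE.
have [S''q|] := boolP (q \in S'' _); rewrite ?mulr0 // mulr1.
by case: ifP => // /andP[/Ssub ->].
Qed.

Let maskD i : N' i + N'' i = mask K (S i).
Proof.
apply/matrixP => p q; rewrite !mxE Spart -mulrnDl; congr (_ *+ _).
have := @Sdisj i p; case: (p \in S' i) (p \in S'' i) => [] [] //;
  rewrite ?addr0 ?add0r //.
by move/(_ isT).
Qed.

Let restr_maskr i : restr S i *m (N' i + N'' i) = restr S i.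
Proof.
rewrite maskD; apply/matrixP => p q; rewrite mul_maskE !mxE.
by case: (p \in S i.+1) (q \in S i) => [] []; rewrite ?mulr1 ?mulr0.
Qed.

Let restr_maskl i : (N' i.+1 + N'' i.+1) *m restr S i = restr S i.
Proof.
rewrite maskD; apply/matrixP => p q; rewrite mask_mulE !mxE.
by case: (p \in S i.+1) (q \in S i) => [] []; rewrite ?mul1r ?mul0r.
Qed.

Let ineq1 i : (brank S' i + brank S'' i <= brank S i)%N.
Proof.
case: i => //= i; rewrite -restr_sub -restr_quo.
exact/rank_restrict_project/restr_mix.
Qed.

Let ineq2 i : (brank S' i + brank S i.+1 <= #|S' i| + brank S'' i.+1)%N.
Proof.
rewrite -(rank_mask K (S' i)) -/(N' i) /= -restr_quo; case: i => [|i] /=.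
  (* Nothing leaves degree 0; a zero matrix without columns stands for the outgoing map. *)
  have := @rank_sub_cycles K _ _ 0 (restr S 0) 0 (N' 0) (N'' 0)
    (restr_maskr 0) (mulmx0 _ _).
  by rewrite mulmx0 mxrank0.
rewrite -restr_sub.
exact: (rank_sub_cycles (restr_maskr i.+1) (Scplx i)).
Qed.

Let ineq3 i : (brank S'' i.+1 + brank S i <= #|S'' i| + brank S' i)%N.
Proof.
rewrite -(rank_mask K (S'' i)) -/(N'' i) /= -restr_quo; case: i => [|i] /=.
  by rewrite !addn0 mxrankM_maxr.
rewrite -restr_sub.
exact: (rank_quotient_boundaries (restr_maskl i) (Scplx i)).
Qed.

(** The long exact sequence of the subcomplex [S'] and the quotient [S''], read off from ranks:
    [r i] is the rank of [H_i(S') -> H_i(S)], [s i] that of [H_i(S) -> H_i(S'')], and [d i] that of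
    the connecting map [H_(i+1)(S'') -> H_i(S')]. The inequalities [ineq1], [ineq2], [ineq3] say
    that [d], [r], [s] are non-negative, so the truncated subtractions are exact. *)
Lemma hom_dim_exact f f' : hom_dim S f -> hom_dim S' f' ->
  exists r s d : nat -> nat,
    [/\ forall i, f' i = (d i + r i)%N, forall i, f i = (r i + s i)%N &
        hom_dim S'' (fun i => s i + if i is j.+1 then d j else 0)%N].
Proof.
move=> hS hS'.
pose d i := (brank S i.+1 - brank S' i.+1 - brank S'' i.+1)%N.
exists (fun i => f' i - d i)%N, (fun i => f i - (f' i - d i))%N, d.
have all i := conj (hS i) (conj (hS' i) (conj (ineq1 i) (conj (ineq1 i.+1)
  (conj (ineq2 i) (conj (ineq3 i) (card_split i)))))).
split=> i.
- by have := all i; have := all i.+1; rewrite /d; lia.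
- by have := all i; have := all i.+1; rewrite /d; lia.
case: i => [|i]; cbv beta iota; rewrite /d.
  have z0 : [/\ brank S 0 = 0, brank S' 0 = 0 & brank S'' 0 = 0]%N by [].
  have := all 0%N; have := all 1%N; case: z0; lia.
have := all i; have := all i.+1; have := all i.+2; lia.
Qed.

(** The maps [H_i(S') -> H_i(S)] vanish, one end being zero, and the long exact sequence breaks into
    short ones. *)
Lemma hom_dim_split f f' : hom_dim S f -> hom_dim S' f' ->
    (forall i, f i = 0%N \/ f' i = 0%N) ->
  hom_dim S'' (fun i => f i + if i is j.+1 then f' j else 0)%N.
Proof.
move=> hS hS' ff'; have [r [s [d [f'E fE hS'']]]] := hom_dim_exact hS hS'.
apply: eq_hom_dim hS'' => -[|i].
  by have := ff' 0%N; have := f'E 0%N; have := fE 0%N; lia.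
have := ff' i.+1; have := f'E i.+1; have := fE i.+1.
by have := ff' i; have := f'E i; have := fE i; lia.
Qed.

(** As the quotient has no vectors in degree 0, [H_0(S') -> H_0(S)] is onto; both spaces have
    dimension [c], so it is bijective and the connecting map into [H_0(S')] is zero. *)
Lemma hom_dim_cone (c : nat) :
    hom_dim S (fun i => if i is 0 then c else 0)%N ->
    hom_dim S' (fun i => if i is 0 then c else 0)%N ->
    #|S'' 0| = 0%N ->
  hom_dim S'' (fun=> 0%N).
Proof.
move=> hS hS' S0; have [r [s [d [f'E fE hS'']]]] := hom_dim_exact hS hS'.
have h0 := hS'' 0%N; rewrite S0 /= in h0.
apply: eq_hom_dim hS'' => -[|[|i]].
- lia.
- by have := f'E 0%N; have := fE 0%N; have := f'E 1%N; have := fE 1%N; lia.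
by have := f'E i.+1; have := fE i.+1; have := f'E i.+2; have := fE i.+2; lia.
Qed.

End LongExactSequence.

End BasisSubsets.

(** * Scalar form of a minimal multigraded resolution *)

Section GradedComplexes.

Variables (K : fieldType) (n : nat).

(** Such rows are the coordinates of the degree-[c] component of the free module, each basis vector
    being multiplied by the monomial that raises its degree to [c]. *)
Definition supported r (dg : 'I_r -> 'X_{1..n}) (c : 'X_{1..n})
    (v : 'rV[K]_r) : Prop :=
  forall p, v 0 p != 0 -> (dg p <= c)%MM.

(* The linear algebra behind a minimal multigraded resolution of R / I, where
   [inI] tells which monomials lie in I: the entry (p, q) of the i-th
   differential is [D i p q] times the monomial of degree [deg p - deg q]. *)
Record kresolution (inI : pred 'X_{1..n}) (rk : nat -> nat)
    (deg : forall i, 'I_(rk i) -> 'X_{1..n})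
    (D : forall i, 'M[K]_(rk i.+1, rk i)) : Prop := KResolution {
  kres_base : exists q0 : 'I_(rk 0), forall q, q = q0;
  kres_deg0 : forall q : 'I_(rk 0), deg 0%N q = 0%MM;
  kres_le : forall i p q, D i p q != 0 -> (deg i q <= deg i.+1 p)%MM;
  kres_min : forall i p q, deg i.+1 p = deg i q -> D i p q = 0;
  kres_cplx : forall i, D i.+1 *m D i = 0;
  kres_exact : forall i c (v : 'rV_(rk i.+1)),
    supported (deg i.+1) c v -> v *m D i = 0 ->
    exists2 w, supported (deg i.+2) c w & v = w *m D i.+1;
  kres_image : forall c,
    inI c <-> exists2 w, supported (deg 1%N) c w & w *m D 0%N != 0
}.

End GradedComplexes.

(* The subsets of size at least w of a set of size e span a quotient of the
   simplex chain complex; its homology has this dimension, in degree w. *)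
Definition ncompositions (e w : nat) : nat :=
  match e, w with
  | 0, 0 => 1
  | e'.+1, w'.+1 => 'C(e', w')
  | _, _ => 0
  end.

(** This Pascal rule mirrors the exact sequence that adds one variable to the set. *)
Lemma ncompositionsS e w :
  ncompositions e.+1 w.+1 = (ncompositions e w.+1 + ncompositions e w)%N.
Proof. by case: e w => [|e] [|w] //=; rewrite ?bin0 ?binS. Qed.

(** * Multigraded Betti numbers by adding variables one at a time *)

Section MultigradedBetti.

Variables (K : fieldType) (n : nat) (inI : pred 'X_{1..n}) (rk : nat -> nat).
Variables (deg : forall i, 'I_(rk i) -> 'X_{1..n}).
Variables (D : forall i, 'M[K]_(rk i.+1, rk i)).
Hypothesis resD : kresolution inI deg D.

Variables (b : 'X_{1..n}) (C : finType) (cls : 'I_n -> C) (need : C -> nat).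

Definition fibre (A : {set 'I_n}) (s : C) : {set 'I_n} := [set j in A | cls j == s].

Definition mnm_lower (T : {set 'I_n}) : 'X_{1..n} :=
  [multinom b l - (l \in T) | l < n].

Let V : {set 'I_n} := [set l | b l != 0%N].

Hypothesis inI_lower : forall T : {set 'I_n}, T \subset V ->
  inI (mnm_lower T) = ~~ [forall s, need s <= #|fibre T s|]%N.

Definition slice (A T : {set 'I_n}) (i : nat) : {set 'I_(rk i)} :=
  [set p | (deg p <= mnm_lower T)%MM && [forall (l | l \in A), deg p l == b l]].

Let rest (T : {set 'I_n}) s := (need s - #|fibre T s|)%N.

(** The expected homology behaves like that of a tensor product over the classes: the degrees of the
    factors, which are the unmet needs, add up and the dimensions multiply. *)
Let shape (A T : {set 'I_n}) (i : nat) : nat :=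
  ((i == \sum_s rest T s) * \prod_s ncompositions #|fibre A s| (rest T s))%N.

(** Slices are convex for divisibility: if [q] contributes to the entry from [p] to [r], its degree
    lies between theirs, so [q] is in the slice along with [p] and [r]. *)
Lemma slice_cplx A T i :
  restr D (slice A T) i.+1 *m restr D (slice A T) i = 0.
Proof.
apply/matrixP => p r; rewrite !mxE.
have := congr1 (fun M : 'M_(_, _) => M p r) (kres_cplx resD i); rewrite !mxE.
have [/andP[hp hr] E|nhpr _] := boolP ((p \in slice A T i.+2) && (r \in slice A T i)).
  rewrite -[RHS]E; apply: eq_bigr => q _; rewrite !mxE hp hr andbT /=.
  have [//|hq] := boolP (q \in slice A T i.+1); rewrite mul0r; apply/esym/eqP.
  rewrite mulf_eq0; apply: contraT => /norP[/(kres_le resD) /mnm_lepP qp].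
  move=> /(kres_le resD) /mnm_lepP rq; case/negP: hq; move: hp hr; rewrite !inE.
  move=> /andP[/mnm_lepP pT /forall_inP pA] /andP[/mnm_lepP rT /forall_inP rA].
  apply/andP; split; first by apply/mnm_lepP => l; apply: leq_trans (qp l) (pT l).
  apply/forall_inP => l lA; have := qp l; have := rq l.
  by rewrite (eqP (pA l lA)) (eqP (rA l lA)) eqn_leq => -> ->.
apply: big1 => q _; rewrite !mxE; move: nhpr.
by case: (p \in _) (r \in _) => [] [] //= _; rewrite ?andbF ?mulr0 ?mul0r.
Qed.

Section Step.

Variables (A T : {set 'I_n}) (j : 'I_n).
Hypotheses (jV : j \in V) (jT : j \notin T).

(** The exponent at [j] is either the full [b j] or at most [b j - 1], and the latter bound is what
    adding [j] to [T] imposes. *)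
Lemma slice_part i p :
  (p \in slice A T i) = (p \in slice A (j |: T) i) || (p \in slice (j |: A) T i).
Proof.
have bj : (0 < b j)%N by move: jV; rewrite inE lt0n.
have cT l : mnm_lower (j |: T) l = if l == j then (b j).-1 else mnm_lower T l.
  rewrite !mnmE !inE; case: eqP => [->|] //=; lia.
rewrite !inE; apply/andP/orP => [[/mnm_lepP h1 /forall_inP h2]|].
  have [E|E] := eqVneq (deg p j) (b j); [right|left]; apply/andP; split.
  - exact/mnm_lepP.
  - by apply/forall_inP => l /setU1P[->|/h2//]; rewrite E.
  - apply/mnm_lepP => l; rewrite cT; case: eqP => [->|//].
    have := h1 j; rewrite mnmE (negPf jT); lia.
  - exact/forall_inP.
case=> /andP[/mnm_lepP h1 /forall_inP h2]; split.
- apply/mnm_lepP => l; have := h1 l; rewrite cT mnmE.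
  by case: eqP => [->|//]; rewrite (negPf jT); lia.
- exact/forall_inP.
- exact/mnm_lepP.
- by apply/forall_inP => l lA; apply: h2; rewrite inE lA orbT.
Qed.

Let lower_lt i p : p \in slice A (j |: T) i -> (deg p j < b j)%N.
Proof.
rewrite inE => /andP[/mnm_lepP/(_ j) + _]; rewrite mnmE setU11.
by move: jV; rewrite inE; lia.
Qed.

Let upper_eq i p : p \in slice (j |: A) T i -> deg p j = b j.
Proof. by rewrite inE => /andP[_ /forall_inP/(_ j (setU11 _ _))/eqP]. Qed.

Lemma slice_disj i p : p \in slice A (j |: T) i -> p \notin slice (j |: A) T i.
Proof. by move=> /lower_lt h; apply/negP => /upper_eq E; rewrite E ltnn in h. Qed.

Lemma slice_sub i p q :
  p \in slice A (j |: T) i.+1 -> q \in slice (j |: A) T i -> D i p q = 0.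
Proof.
move=> /lower_lt h /upper_eq E; apply/eqP/contraT => /(kres_le resD)/mnm_lepP/(_ j).
by rewrite E leqNgt h.
Qed.

End Step.

(** The slice spans the degree-[c] component of the resolution, which is exact except in degree 0,
    where its homology is that component of R/I. *)
Lemma slice0_hom_dim (T : {set 'I_n}) : T \subset V ->
  hom_dim D (slice set0 T) (fun i => if i is 0 then ~~ inI (mnm_lower T) else 0)%N.
Proof.
move=> TV; set c := mnm_lower T; set S := slice set0 T.
have SE i p : (p \in S i) = (deg p <= c)%MM.
  rewrite inE andbC; case: forall_inP => // -[] l; by rewrite inE.
have supp i (v : 'rV_(rk i)) : supported (@deg i) c v <-> v *m mask K (S i) = v.
  split=> [h|h p]; last first.
    by rewrite -h mul_maskE SE; case: (_ <= _)%MM => //; rewrite mulr0 eqxx.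
  apply/rowP => p; rewrite mul_maskE SE; have [->|/h ->] := eqVneq (v 0 p) 0.
    by rewrite mul0r.
  by rewrite mulr1.
(* Only the rows need a mask, since a non-zero entry leads to a smaller degree. *)
have restrE i : restr D S i = mask K (S i.+1) *m D i.
  apply/matrixP => p q; rewrite mask_mulE !mxE !SE.
  case: (boolP (deg p <= c)%MM) => [pc|_]; rewrite /= ?mul0r // mul1r.
  case: ifP => // /negP qc; apply/esym/eqP/contraT => /(kres_le resD) qp.
  by case: qc; apply: lepm_trans qp pc.
case=> [|i] /=.
  have S0 : S 0%N = setT.
    apply/setP => p; rewrite SE inE (kres_deg0 resD).
    by apply/mnm_lepP => l; rewrite mnm0E.
  have [q0 qE] := kres_base resD.
  have r1 : rk 0 = 1%N.
    by rewrite -(card_ord (rk 0)) -cardsT; apply/eqP/cards1P; exists q0;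
      apply/setP => q; rewrite !inE (qE q) eqxx.
  rewrite S0 cardsT card_ord [LHS]r1 addn0.
  have rle : (\rank (restr D S 0) <= 1)%N.
    by apply: leq_trans (rank_leq_col _) _; rewrite r1.
  have [/(kres_image resD)[w wc wD]|nI] := boolP (inI c).
    suff : \rank (restr D S 0) != 0%N by rewrite /=; lia.
    rewrite mxrank_eq0; apply: contra wD => /eqP E.
    by rewrite -(proj1 (supp _ _) wc) -mulmxA -restrE E mulmx0.
  suff -> : restr D S 0 = 0 by rewrite mxrank0.
  apply/eqP/rowV0P => v /submxP[w ->]; apply/eqP/contraT => h; case/negP: nI.
  apply/(kres_image resD); exists (w *m mask K (S 1%N)).
    by apply/supp; rewrite -mulmxA; congr (_ *m _); apply/matrixP => p q;
      rewrite mul_maskE !mxE; case: (p =P q) => [->|_]; rewrite ?mulr1n ?mul0r //;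
      rewrite -natrM mulnb andbb.
  by rewrite -mulmxA -restrE.
have := mxrank_mul_ker (mask K (S i.+1)) (D i).
rewrite rank_mask -restrE => <-; rewrite add0n addnC; congr (_ + _)%N.
apply/eqmx_rank/andP; split; last first.
  rewrite sub_capmx; apply/andP; split.
    apply/submxP; exists (restr D S i.+1); apply/matrixP => p q.
    by rewrite mul_maskE !mxE; case: (q \in S i.+1); rewrite ?andbF ?mulr1 ?mulr0.
  by apply/sub_kermxP; rewrite restrE -mulmxA (kres_cplx resD) mulmx0.
apply/row_subP => k; set v := row k _.
have vc : (v <= mask K (S i.+1) :&: kermx (D i))%MS by apply: row_sub.
rewrite sub_capmx in vc; have [||w wc ->] := kres_exact resD (c := c) (v := v).
- case/andP: vc => /submxP[u ->] _ p; rewrite mul_maskE SE.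
  by case: (_ <= _)%MM => //; rewrite mulr0 eqxx.
- by case/andP: vc => _ /sub_kermxP.
by rewrite -(proj1 (supp _ _) wc) -mulmxA -restrE submxMl.
Qed.

Let card_fibreU1 (T : {set 'I_n}) j s : j \notin T ->
  #|fibre (j |: T) s| = ((cls j == s) + #|fibre T s|)%N.
Proof.
move=> jT; have [E|ne] := eqVneq (cls j) s.
  rewrite (_ : fibre (j |: T) s = j |: fibre T s) ?cardsU1 ?inE ?(negPf jT) //.
  by apply/setP => l; rewrite !inE; case: eqP => [->|//] /=; rewrite E eqxx.
congr #|pred_of_set _|; apply/setP => l; rewrite !inE.
by case: eqP => [->|//]; rewrite (negPf ne) (negPf jT).
Qed.

Let restU1 (T : {set 'I_n}) j s : j \notin T ->
  rest (j |: T) s = (rest T s - (cls j == s))%N.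
Proof. by move=> jT; rewrite /rest card_fibreU1 // addnC subnDA. Qed.

Let inI_rest (T : {set 'I_n}) : T \subset V ->
  ~~ inI (mnm_lower T) = [forall s, rest T s == 0%N].
Proof.
by move=> TV; rewrite inI_lower // negbK; apply: eq_forallb => s; rewrite subn_eq0.
Qed.

(** The class of [j] needs nothing more, so adding [j] to [T] does not change membership in I. For
    [A] reduced to [j] this is the cone situation; the other variables of [A] are then added by
    exact sequences between acyclic complexes. *)
Lemma slice_acyclic (j : 'I_n) (A T : {set 'I_n}) :
    j \in A -> A \subset V -> T \subset V -> [disjoint A & T] ->
    rest T (cls j) = 0%N ->
  hom_dim D (slice A T) (fun=> 0%N).
Proof.
elim: {A}_.+1 {-2}A (ltnSn #|A|) T => // m IH A Am T jA AV TV AT r0.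
have jT : j \notin T by rewrite (disjointFr AT jA).
have jV := subsetP AV _ jA.
have [A0|/set0Pn[j' j'A]] := eqVneq (A :\ j) set0.
  have -> : A = j |: set0 by rewrite -A0 setD1K.
  apply: (@hom_dim_cone _ _ _ _ _ _ (slice_part set0 jV jT)
    (slice_disj jV jT) (slice_sub jV jT) (slice_cplx _ _) (~~ inI (mnm_lower T))).
  - exact: slice0_hom_dim.
  - have jTV : j |: T \subset V by rewrite subUset sub1set jV.
    have -> : ~~ inI (mnm_lower T) = ~~ inI (mnm_lower (j |: T)).
      rewrite !inI_rest //; apply: eq_forallb => s; rewrite restU1 //.
      by have [<-|_] := eqVneq (cls j) s; rewrite ?r0 ?subn0.
    exact: slice0_hom_dim.
  (* The quotient is empty in homological degree 0, where the basis vector has degree 0 while [b j]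
     is positive. *)
  apply/eqP; rewrite cards_eq0; apply/eqP/setP => p; rewrite !inE.
  apply/negP => /andP[_ /forall_inP/(_ j (setU11 _ _))].
  by rewrite (kres_deg0 resD) mnm0E eq_sym; apply/negP; move: jV; rewrite inE.
case/setD1P: j'A => j'j j'A.
have j'T : j' \notin T by rewrite (disjointFr AT).
have j'V := subsetP AV _ j'A.
have jA' : j \in A :\ j' by rewrite !inE eq_sym j'j.
have A'V : A :\ j' \subset V by apply: subset_trans (subsetDl _ _) AV.
have A'm : (#|A :\ j'| < m)%N by move: Am; rewrite (cardsD1 j' A) j'A add1n ltnS.
have A'T : [disjoint A :\ j' & T] by apply: disjointWl (subsetDl _ _) AT.
have A'T' : [disjoint A :\ j' & j' |: T].
  rewrite disjoints_subset; apply/subsetP => l; rewrite !inE negb_or.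
  by move=> /andP[-> lA]; rewrite (disjointFr AT lA).
have hS : hom_dim D (slice (A :\ j') T) (fun=> 0%N) by apply: IH.
have hS' : hom_dim D (slice (A :\ j') (j' |: T)) (fun=> 0%N).
  by apply: IH => //; rewrite ?subUset ?sub1set ?j'V // restU1 // r0.
rewrite -(setD1K j'A).
have := hom_dim_split (slice_part _ j'V j'T) (slice_disj j'V j'T) (slice_sub j'V j'T)
  (slice_cplx _ _) hS hS' (fun _ => or_introl erefl).
by apply: eq_hom_dim => -[].
Qed.

(** Induction on the size of [A]. If a variable of [A] has a satisfied class, the slice is acyclic
    and the factor of that class in [shape] is zero. Otherwise any [j] in [A] is removed, and the
    two slices obtained for [T] and for [j |: T] are combined by the Pascal rule. *)
Lemma slice_hom_dim (A T : {set 'I_n}) :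
    A \subset V -> T \subset V -> [disjoint A & T] ->
  hom_dim D (slice A T) (shape A T).
Proof.
elim: {A}_.+1 {-2}A (ltnSn #|A|) T => // m IH A Am T AV TV AT.
have [->|/set0Pn[j jA]] := eqVneq A set0.
  apply: eq_hom_dim (slice0_hom_dim TV) => i; rewrite inI_rest // /shape.
  have f0 s : #|fibre set0 s| = 0%N.
    by apply/eqP; rewrite cards_eq0; apply/eqP/setP => l; rewrite !inE.
  under [(\prod_s _)%N]eq_bigr => s _ do rewrite f0.
  have [/forallP r0|/forallPn[s rs]] := boolP [forall s, rest T s == 0%N].
    rewrite (eq_bigr (fun=> 0%N)) => [|s _]; last exact/eqP.
    rewrite sum_nat_const muln0 big1 => [|s _]; last by rewrite (eqP (r0 s)).
    by case: i.
  rewrite [(\prod_s _)%N](bigD1 s) //=; move: rs; case: (rest T s) => // x _.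
  by rewrite mul0n muln0; case: i.
have [/exists_inP[j0 j0A /eqP r0]|/exists_inPn nr0] :=
    boolP [exists (j0 | j0 \in A), rest T (cls j0) == 0%N].
  apply: eq_hom_dim (slice_acyclic j0A AV TV AT r0) => i.
  rewrite /shape [(\prod_s _)%N](bigD1 (cls j0)) //= r0.
  have : (0 < #|fibre A (cls j0)|)%N by apply/card_gt0P; exists j0; rewrite !inE j0A /=.
  by case: #|_| => // x _; rewrite mul0n muln0.
have jT : j \notin T by rewrite (disjointFr AT).
have jV := subsetP AV _ jA.
have A'V : A :\ j \subset V by apply: subset_trans (subsetDl _ _) AV.
have A'm : (#|A :\ j| < m)%N by move: Am; rewrite (cardsD1 j A) jA add1n ltnS.
have A'T : [disjoint A :\ j & T] by apply: disjointWl (subsetDl _ _) AT.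
have A'T' : [disjoint A :\ j & j |: T].
  rewrite disjoints_subset; apply/subsetP => l; rewrite !inE negb_or.
  by move=> /andP[-> lA]; rewrite (disjointFr AT lA).
have hS := IH (A :\ j) A'm T A'V TV A'T.
have jTV : j |: T \subset V by rewrite subUset sub1set jV.
have hS' := IH (A :\ j) A'm (j |: T) A'V jTV A'T'.
have rj : (0 < rest T (cls j))%N by rewrite lt0n nr0.
(* Adding [j] to [T] lowers the total need by one, so the two homologies sit in different degrees
   and the sequence splits. *)
have sumE : (\sum_s rest T s = (\sum_s rest (j |: T) s).+1)%N.
  rewrite (bigD1 (cls j)) //= [in RHS](bigD1 (cls j)) //= restU1 // eqxx.
  rewrite (eq_bigr (rest (j |: T))) => [|s sj]; first by rewrite subn1 -addSn prednK.
  by rewrite restU1 // eq_sym (negPf sj) subn0.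
have := hom_dim_split (slice_part _ jV jT) (slice_disj jV jT) (slice_sub jV jT)
  (slice_cplx _ _) hS hS'; rewrite setD1K // => /(_ _) h.
apply: eq_hom_dim (h _) => i; last first.
  rewrite /shape sumE; case: eqP => [->|]; last by left.
  by right; rewrite eqn_leq ltnn mul0n.
rewrite [in RHS]/shape -[in RHS](setD1K jA).
rewrite [(\prod_s _)%N in RHS](bigD1 (cls j)) //= card_fibreU1 ?setD11 // eqxx add1n.
case E : (rest T (cls j)) rj => [//|x] _; rewrite ncompositionsS mulnDl.
have pE : (\prod_(s | s != cls j) ncompositions #|fibre (j |: A :\ j) s| (rest T s) =
    \prod_(s | s != cls j) ncompositions #|fibre (A :\ j) s| (rest T s))%N.
  by apply: eq_bigr => s sj; rewrite card_fibreU1 ?setD11 // eq_sym (negPf sj).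
have pE' : (\prod_(s | s != cls j) ncompositions #|fibre (A :\ j) s| (rest (j |: T) s) =
    \prod_(s | s != cls j) ncompositions #|fibre (A :\ j) s| (rest T s))%N.
  by apply: eq_bigr => s sj; rewrite restU1 // eq_sym (negPf sj) subn0.
rewrite pE mulnDr; congr (_ + _)%N.
  by rewrite /shape [(\prod_s _)%N](bigD1 (cls j)) //= E.
rewrite /shape sumE; case: i => [//|i]; rewrite [(\prod_s _)%N](bigD1 (cls j)) //= pE'.
by rewrite restU1 // eqxx E subn1 eqSS.
Qed.

Theorem multigraded_betti i :
  #|[set p : 'I_(rk i) | deg p == b]| =
  ((i == \sum_s need s) * \prod_s ncompositions #|fibre V s| (need s))%N.
Proof.
have V0 : [disjoint V & set0] by rewrite -setI_eq0 setI0.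
have := slice_hom_dim (subxx V) (sub0set V) V0 i.
have f0 s : rest set0 s = need s.
  rewrite /rest (_ : fibre set0 s = set0) ?cards0 ?subn0 //.
  by apply/setP => l; rewrite !inE.
(* Off the support of [b], the bound on the degree already forces the exponent 0. *)
have sE i' : slice V set0 i' = [set p | deg p == b].
  apply/setP => p; rewrite !inE; apply/andP/eqP => [[/mnm_lepP h1 /forall_inP h2]|->].
    apply/mnmP => l; have [lV|] := boolP (l \in V); first exact/eqP/h2.
    by have := h1 l; rewrite mnmE !inE negbK => h /eqP E; move: h; rewrite E; lia.
  by split; [apply/mnm_lepP => l; rewrite mnmE inE subn0|apply/forall_inP].
have r0 i' : restr D (slice V set0) i' = 0.
  apply/matrixP => p q; rewrite !mxE !sE !inE.
  by case: andP => // -[/eqP pb /eqP qb]; rewrite (kres_min resD) // pb qb.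
rewrite sE /shape /brank !r0 mxrank0 addn0.
under eq_bigr => s _ do rewrite f0.
under [(\prod_s _)%N]eq_bigr => s _ do rewrite f0.
by case: i => [|i] ->; rewrite ?r0 ?mxrank0 addn0.
Qed.

End MultigradedBetti.

(** * Counting the permutations of a word *)

Section Multinomial.

Local Open Scope nat_scope.

(** Induction on the length, sorting the permutations by their first letter. Letters of [r] foreign
    to [s] are harmless, contributing the factorial of 0. *)
Lemma size_permutations_multinomial (T : eqType) (r s : seq T) :
    uniq r -> {subset s <= r} ->
  size (permutations s) * \prod_(x <- r) (count_mem x s)`! = (size s)`!.
Proof.
move=> ur; elim: {s}(size s) {-2}s (erefl (size s)) => [|m IH] s sm sr.
  by rewrite (size0nil sm) big1.
have s0 : 0 < size s by rewrite sm.
rewrite (perm_size (permutationsE s0)) size_allpairs_dep sumnE big_map big_distrl.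
transitivity (\sum_(x <- undup s) count_mem x s * m`!); last first.
  rewrite -big_distrl /= [in RHS]sm factS; congr (_ * _).
  rewrite -sm -(perm_size (perm_count_undup s)) size_flatten sumnE !big_map.
  by apply: eq_bigr => x _; rewrite size_nseq.
apply: eq_big_seq => x; rewrite mem_undup => xs.
have xr := sr x xs.
have E : size (rem x s) = m by rewrite size_rem // sm.
rewrite -[in RHS]E -(IH (rem x s) E) => [|y /mem_rem/sr //].
rewrite mulnCA; congr (_ * _).
rewrite (bigD1_seq x) //= [in RHS](bigD1_seq x) //= count_rem xs /= eqxx.
have cx : 0 < count_mem x s by rewrite -has_count has_pred1.
rewrite -{1}(prednK cx) factS prednK // subn1 -mulnA; congr (_ * (_ * _)).
by apply: eq_bigr => y /negPf yx; rewrite count_rem xs /= eq_sym yx subn0.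
Qed.

End Multinomial.

(** * Blocks of a subset and the exponents of its degree *)

Section IsolatedSets.

Local Open Scope nat_scope.

Variable n : nat.
Implicit Types (J : {set 'I_n}).

Let els J := [seq (val j).+1 | j <- enum J].

Let size_els J : size (els J) = #|J|.
Proof. by rewrite size_map -cardE. Qed.

Let sorted_els J : sorted ltn (els J).
Proof.
have -> : els J = [seq i.+1 | i <- [seq val j | j <- enum J]] by rewrite -map_comp.
rewrite sorted_map; apply: (@sub_sorted _ ltn) => [x y //|].
apply: (subseq_sorted ltn_trans) (iota_ltn_sorted 0 n).
by rewrite -val_enum_ord map_subseq // enumT filter_subseq.
Qed.

Lemma elt0 J : elt J 0 = 0. Proof. by []. Qed.

Lemma elt_last J : elt J #|J|.+1 = n.
Proof. by rewrite /elt /= nth_rcons -/(els J) size_els ltnn eqxx. Qed.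

Let eltS J a : a < #|J| -> elt J a.+1 = nth 0 (els J) a.
Proof. by move=> aJ; rewrite /elt /= nth_rcons -/(els J) size_els aJ. Qed.

Lemma eltP J (j : 'I_n) : reflect (exists2 a, a < #|J| & elt J a.+1 = j.+1) (j \in J).
Proof.
apply: (iffP idP) => [jJ|[a aJ]].
  have jm : j.+1 \in els J by apply: map_f; rewrite mem_enum.
  exists (index j.+1 (els J)); first by rewrite -size_els index_mem.
  by rewrite eltS ?nth_index // -size_els index_mem.
rewrite eltS // => E; have : j.+1 \in els J by rewrite -E mem_nth // size_els.
by case/mapP => j' + [/val_inj ->]; rewrite mem_enum.
Qed.

Lemma elt_mem J a : a < #|J| -> exists2 j : 'I_n, j \in J & elt J a.+1 = j.+1.
Proof.
move=> aJ; have : elt J a.+1 \in els J by rewrite eltS // mem_nth // size_els.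
by case/mapP => j; rewrite mem_enum; exists j.
Qed.

Lemma elt_lt J a : a < #|J| -> elt J a < elt J a.+1.
Proof.
case: a => [|a] aJ; first by have [j _ ->] := elt_mem aJ.
rewrite !eltS //; last exact: ltnW.
by apply: (sorted_ltn_nth ltn_trans 0 (sorted_els J)); rewrite ?inE ?size_els // ltnW.
Qed.

Lemma elt_le_n J a : a <= #|J| -> elt J a <= n.
Proof. by case: a => // a /elt_mem[j _ ->]. Qed.

Lemma elt_leS J a : a <= #|J| -> elt J a <= elt J a.+1.
Proof.
rewrite leq_eqVlt => /orP[/eqP->|/elt_lt/ltnW//].
by rewrite elt_last elt_le_n.
Qed.

Lemma elt_ltn J a c : a < c -> c <= #|J| -> elt J a < elt J c.
Proof.
move=> + cJ; elim: c cJ => // c IH cJ; rewrite ltnS leq_eqVlt => /orP[/eqP->|ac].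
  exact: elt_lt.
by apply: ltn_trans (IH _ ac) (elt_lt cJ); apply: ltnW.
Qed.

Lemma elt_leq J a c : a <= c -> c <= #|J| -> elt J a <= elt J c.
Proof. by rewrite leq_eqVlt => /orP[/eqP->//|ac] /(elt_ltn ac)/ltnW. Qed.

(* The elements of J are numbered from 1 here, and 0 is the default value. *)
Definition top J s : nat := \max_(j in J | j < s) j.+1.

Lemma ltn_top J s l : reflect (exists2 j : 'I_n, j \in J & l <= j < s) (l < top J s).
Proof.
apply: (iffP idP) => [|[j jJ /andP[lj js]]]; last first.
  by apply: leq_trans (_ : j.+1 <= _) => //; apply: (bigmax_sup j); rewrite ?jJ.
move=> lt; apply/exists_inP; apply: contraLR lt => /exists_inPn ne; rewrite -leqNgt.
apply/bigmax_leqP => j /andP[jJ js]; have := ne j jJ; rewrite js andbT.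
by rewrite -ltnNge.
Qed.

Lemma top_le J s : top J s <= s.
Proof. by apply/bigmax_leqP => j /andP[]. Qed.

Lemma top_le_n J s : top J s <= n.
Proof. by apply/bigmax_leqP. Qed.

Lemma topS_in J (j : 'I_n) : j \in J -> top J j.+1 = j.+1.
Proof.
move=> jJ; apply/eqP; rewrite eqn_leq top_le.
by apply/ltn_top; exists j => //; rewrite leqnn ltnSn.
Qed.

Lemma topS_notin J (j : 'I_n) : j \notin J -> top J j.+1 = top J j.
Proof.
move=> jJ; apply: eq_bigl => l; rewrite ltnS leq_eqVlt.
by case: (l =P j :> nat) => [/val_inj ->|]; rewrite ?(negPf jJ).
Qed.

Lemma top_elt J a s : a <= #|J| -> elt J a <= s -> (a < #|J| -> s < elt J a.+1) ->
  top J s = elt J a.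
Proof.
move=> aJ as_ sa; apply/eqP; rewrite eqn_leq; apply/andP; split.
  apply/bigmax_leqP => j /andP[/eltP[c cJ <-] cs].
  have [ca|ac] := ltnP c a; first exact: elt_leq.
  have sa' := sa (leq_ltn_trans ac cJ).
  by have := leq_trans sa' (leq_trans (elt_leq (ac : a < c.+1) cJ) cs); rewrite ltnn.
case: a aJ as_ {sa} => // a aJ as_; have [j jJ E] := elt_mem aJ.
by rewrite E; apply/ltn_top; exists j => //; rewrite leqnn -E.
Qed.

Lemma top_last J : top J n = elt J #|J|.
Proof. by apply: top_elt => //; rewrite ?elt_le_n // ltnn. Qed.

(** As ordinals start at 0, the interval of variables from [j_a + 1] to [j_(a+1)] reads
    [elt J a <= l < elt J a.+1]. *)
Lemma elt_block J l : l < elt J #|J| ->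
  exists2 a, a < #|J| & elt J a <= l < elt J a.+1.
Proof.
suff H t : t <= #|J| -> l < elt J t -> exists2 a, a < #|J| & elt J a <= l < elt J a.+1.
  exact: H.
elim: t => [|t IH] tJ lt; first by rewrite elt0 in lt.
have [le|ge] := leqP (elt J t) l; first by exists t => //; rewrite le.
exact: IH (ltnW tJ) ge.
Qed.

Section Degrees.

Variable k : nat.

Let bdegE J l :
  bdeg k J l = \sum_(a < #|J|) (elt J a <= l < elt J a.+1) * lam n k (elt J a.+1).
Proof.
rewrite /bdeg mnm_sumE big_add1 big_mkord; apply: eq_bigr => a _.
rewrite mulmnE /eps mnm_sumE; congr (_ * _).
rewrite big_mkcond (bigD1 l) //= big1 ?addn0; last first.
  by move=> l' l'l; rewrite mnm1E (negPf l'l); case: ifP.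
by rewrite mnm1E eqxx ltnS; case: (_ && _).
Qed.

Lemma bdeg_block J (l : 'I_n) a : a < #|J| -> elt J a <= l < elt J a.+1 ->
  bdeg k J l = lam n k (elt J a.+1).
Proof.
move=> aJ /andP[al la]; rewrite bdegE (bigD1 (Ordinal aJ)) //= al la mul1n.
rewrite big1 ?addn0 // => c ca; suff -> : (elt J c <= l < elt J c.+1) = false by [].
have := ltn_ord c; have : c <> a :> nat by move=> E; case/eqP: ca; apply/val_inj.
have [ca' _ cJ|ac _ cJ|//] := ltngtP c a; apply/negP => /andP[cl lc].
  by have := leq_trans (leq_trans lc (elt_leq ca' (ltnW aJ))) al; rewrite ltnn.
by have := leq_trans la (leq_trans (elt_leq ac (ltnW cJ)) cl); rewrite ltnn.
Qed.

Lemma bdeg_out J (l : 'I_n) : elt J #|J| <= l -> bdeg k J l = 0.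
Proof.
move=> tl; rewrite bdegE big1 // => a _.
by rewrite ltnNge (leq_trans (elt_leq (ltn_ord a) (leqnn _)) tl) andbF.
Qed.

Hypothesis kn : k < n.

Lemma bdeg_ge J (l : 'I_n) s : s <= k -> (n.+1 - s <= bdeg k J l) = (l < top J s).
Proof.
move=> sk; apply/idP/idP => [|/ltn_top[j /eltP[c cJ cj] /andP[lj js]]].
  have [tl|lt] := leqP (elt J #|J|) l; first by rewrite bdeg_out // leqn0; lia.
  have [a aJ aP] := elt_block lt; rewrite (bdeg_block aJ aP) /lam => h.
  have [j jJ E] := elt_mem aJ; apply/ltn_top; exists j => //.
  by move: h aP; rewrite E; case: (leqP _ k); have := ltn_ord j; lia.
have [|a aJ aP] := @elt_block J l.
  by apply: leq_trans (elt_leq cJ (leqnn _)); rewrite cj ltnS.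
rewrite (bdeg_block aJ aP) /lam.
have ac : a < c.+1.
  rewrite ltnNge; apply/negP => ca; have := elt_leq ca (ltnW aJ).
  by rewrite cj; case/andP: aP; lia.
by have := elt_leq ac cJ; rewrite cj; case: (leqP _ k); lia.
Qed.

Lemma bdeg_ge_last J (l : 'I_n) : (n - k <= bdeg k J l) = (l < top J n).
Proof.
rewrite top_last; have [tl|lt] := leqP (elt J #|J|) l.
  by rewrite bdeg_out // leqn0; lia.
have [a aJ aP] := elt_block lt; rewrite (bdeg_block aJ aP) /lam.
by have := elt_le_n aJ; case: (leqP _ k); lia.
Qed.

Lemma bdeg_small J (l : 'I_n) : bdeg k J l != 0 -> n - k <= bdeg k J l.
Proof.
rewrite bdeg_ge_last top_last; apply: contraR; rewrite -leqNgt => h.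
by rewrite bdeg_out.
Qed.

End Degrees.

End IsolatedSets.

(** * Betti numbers of the skeleton ideal from level counts *)

Section SkeletonBetti.

Local Open Scope nat_scope.

Variables (n k : nat).
Implicit Types (b m : 'X_{1..n}).

Definition in_skeleton m : bool :=
  [exists A : {set 'I_n},
     [&& A != set0, #|A| <= k.+1 & [forall (j | j \in A), n - #|A| + 1 <= m j]]].

Definition lev b s : nat := #|[set l | n.+1 - s <= b l]|.

(* The variables outside every level set act as cone points. *)
Definition stray b : {set 'I_n} := [set l | (b l != 0) && ~~ (n - k <= b l <= n)].

(** [L] stands for the level counts and [e] for the number of stray variables. There are
    [L t.+1 - L t] variables of exponent [n - t], and [L t.+1 - t] of them must be lowered to leave
    at most [t] exponents reaching [n - t]. *)
Definition betti_value (L : nat -> nat) (e i : nat) : nat :=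
  (i == \sum_(t < k.+1) (L t.+1 - t)) *
  (ncompositions e 0 *
   \prod_(t < k.+1) ncompositions (L t.+1 - L t) (L t.+1 - t)).

Lemma lev_leq b s s' : s <= s' -> lev b s <= lev b s'.
Proof. by move=> ss'; apply/subset_leq_card/subsetP => l; rewrite !inE; lia. Qed.

Lemma lev_le_n b s : lev b s <= n.
Proof. by rewrite -[leqRHS]card_ord max_card. Qed.

(** A generating set [A] of size [t.+1] asks for [t.+1] exponents that are at least [n - t];
    conversely any [t.+1] such variables form an admissible [A]. *)
Lemma in_skeletonE m : k < n ->
  in_skeleton m = [exists t : 'I_k.+1, t < lev m t.+1].
Proof.
move=> kn; apply/existsP/existsP => [[A /and3P[A0 Ak /forall_inP Am]]|[t tm]].
  rewrite -card_gt0 in A0; have Ak' : #|A|.-1 < k.+1 by lia.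
  exists (Ordinal Ak'); rewrite /lev /= prednK //.
  have An : #|A| <= n by lia.
  by apply/subset_leq_card/subsetP => j /Am; rewrite inE addn1 subSn.
have : #|[set l | n.+1 - t.+1 <= m l]| >= t.+1 by [].
rewrite -bin_gt0 -cards_draws card_gt0 => /set0Pn[A].
rewrite !inE => /andP[/subsetP Am /eqP cA]; exists A.
rewrite cA ltn_ord -card_gt0 cA /=; apply/forall_inP => j /Am; rewrite inE.
by have := ltn_ord t; lia.
Qed.

Hypothesis kn : k < n.

Section Levels.

Variable b : 'X_{1..n}.

Definition level (l : 'I_n) : 'I_k.+2 :=
  inord (if n - k <= b l <= n then (n - b l).+1 else 0).

Definition level_need (s : 'I_k.+2) : nat :=
  if val s is t.+1 then lev b t.+1 - t else 0.

Let V : {set 'I_n} := [set l | b l != 0].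

Let levelE l : level l = (if n - k <= b l <= n then (n - b l).+1 else 0) :> nat.
Proof. by rewrite inordK //; case: ifP => // /andP[]; lia. Qed.

Let level_lift l (t : 'I_k.+1) : (level l == lift ord0 t) = (b l == n - t).
Proof.
rewrite -val_eqE /= levelE /bump leq0n add1n; have := ltn_ord t.
by case: ifP; lia.
Qed.

(** Lowering an exponent by one crosses the threshold [n - t] only from the value [n - t] itself, so
    the classes do not interact. *)
Lemma lev_lower (T : {set 'I_n}) (t : 'I_k.+1) :
  lev (mnm_lower b T) t.+1 = lev b t.+1 - #|fibre level T (lift ord0 t)|.
Proof.
rewrite /lev -[#|fibre _ _ _|](_ : #|[set l | n.+1 - t.+1 <= b l] :&:
  fibre level T (lift ord0 t)| = _); last first.
  apply: eq_card => l; rewrite !inE level_lift.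
  by case: (b l =P n - t) => [->|]; rewrite ?andbF // subSS leqnn.
rewrite -cardsD; apply: eq_card => l; rewrite !inE level_lift mnmE.
by have := ltn_ord t; case: (l \in T); rewrite /=; lia.
Qed.

Lemma in_skeleton_lower (T : {set 'I_n}) :
  in_skeleton (mnm_lower b T) = ~~ [forall s, level_need s <= #|fibre level T s|].
Proof.
rewrite in_skeletonE // negb_forall; apply/existsP/existsP => [[t]|[s]].
  rewrite lev_lower => h; exists (lift ord0 t).
  by rewrite /level_need -ltnNge ltn_subRL addnC -ltn_subRL.
case: (unliftP ord0 s) => [t ->|->]; last by rewrite /level_need.
by rewrite /level_need -ltnNge ltn_subRL addnC -ltn_subRL; exists t; rewrite lev_lower.
Qed.

Lemma card_level0 : #|fibre level V ord0| = #|stray b|.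
Proof.
apply: eq_card => l; rewrite !inE; congr (_ && _).
by rewrite -val_eqE /= levelE; case: ifP.
Qed.

Lemma card_level (t : 'I_k.+1) :
  #|fibre level V (lift ord0 t)| = lev b t.+1 - lev b t.
Proof.
have ss : [set l | n.+1 - t <= b l] \subset [set l | n.+1 - t.+1 <= b l].
  by apply/subsetP => l; rewrite !inE; lia.
rewrite /lev -[X in _ - X](_ : #|[set l | n.+1 - t.+1 <= b l] :&:
    [set l | n.+1 - t <= b l]| = _);
  last by rewrite (setIidPr ss).
rewrite -cardsD; apply: eq_card => l; rewrite !inE level_lift.
by have := ltn_ord t; lia.
Qed.

End Levels.

Theorem skeleton_multigraded_betti (K : fieldType) (rk : nat -> nat)
    (deg : forall i, 'I_(rk i) -> 'X_{1..n})
    (D : forall i, 'M[K]_(rk i.+1, rk i)) (i : nat) b :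
    kresolution in_skeleton deg D ->
  #|[set p : 'I_(rk i) | deg i p == b]| = betti_value (lev b) #|stray b| i.
Proof.
move=> resD; have := @multigraded_betti _ _ _ _ _ _ resD b _ (level b) (level_need b).
move=> ->; last by move=> T _; apply: in_skeleton_lower.
rewrite big_ord_recl [X in _ * X]big_ord_recl /betti_value card_level0 add0n.
congr (_ * (_ * _)).
by apply: eq_bigr => t _; rewrite card_level.
Qed.

End SkeletonBetti.

(** * Level counts and dual isolated sets *)

Section IsolatedBetti.

Local Open Scope nat_scope.

Variables (n k : nat).
Hypothesis kn : k < n.
Implicit Types (J : {set 'I_n}) (b c : 'X_{1..n}) (L : nat -> nat).

(** Both types of dual isolated sets at once; they are told apart by comparing [top J n] with
    [k.+1]. *)
Definition isolated J : bool :=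
  (J != set0) && [forall (j | j \in J), (j < k) || (j.+1 == top J n)].

(** On isolated sets this is the dual weight plus one, that is, the homological degree for R/I, in a
    form common to both types. *)
Definition weight J : nat := #|[set j in J | j < k]| + (top J n - k).

Definition isolated_betti J : nat :=
  if k < top J n then 'C(top J n - top J k - 1, top J n - k - 1) else 1.

Definition toplev J s : nat := if s <= k then top J s else top J n.

Lemma card_ltn_ord x : x <= n -> #|[set l : 'I_n | l < x]| = x.
Proof.
move=> xn; rewrite cardsE -sum1_card.
by rewrite -(big_ord_widen n (fun=> 1) xn) sum1_card card_ord.
Qed.

Lemma lev_bdeg J s : s <= k.+1 -> lev (bdeg k J) s = toplev J s.
Proof.
rewrite leq_eqVlt /toplev => /orP[/eqP->|]; rewrite ?ltnn /lev.
  rewrite -[RHS](card_ltn_ord (top_le_n J n)); apply: eq_card => l.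
  by rewrite !inE subSS bdeg_ge_last.
rewrite ltnS => sk; rewrite sk -[RHS](card_ltn_ord (top_le_n J s)).
by apply: eq_card => l; rewrite !inE bdeg_ge.
Qed.

Lemma stray_bdeg J : stray k (bdeg k J) = set0.
Proof.
apply/setP => l; rewrite !inE; apply/negP => /andP[/(bdeg_small kn) -> /=].
rewrite -ltnNge => h; have : n.+1 - 0 <= bdeg k J l by [].
by rewrite bdeg_ge // => /leq_trans/(_ (top_le _ _)).
Qed.

Lemma top_leq J s s' : s <= s' -> top J s <= top J s'.
Proof.
move=> ss'; apply/bigmax_leqP => j /andP[jJ js]; apply: (bigmax_sup j) => //.
by rewrite jJ (leq_trans js).
Qed.

Lemma top_small J : top J n <= k -> top J k = top J n.
Proof.
move=> h; apply/eqP; rewrite eqn_leq top_leq ?(ltnW kn) //=.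
apply/bigmax_leqP => j /andP[jJ _]; apply: (bigmax_sup j) => //; rewrite jJ.
by apply: leq_trans h; apply: (bigmax_sup j); rewrite ?jJ /=.
Qed.

Lemma leq_top_n J (j : 'I_n) : j \in J -> j < top J n.
Proof. by move=> jJ; apply: (bigmax_sup j); rewrite ?jJ /=. Qed.

(** For [t < k] the class [t] contributes a factor 1: if [t.+1] belongs to [J] its need is 1,
    otherwise the class is empty and its need is 0. Only the last class, of exponent [n - k], gives
    a binomial. *)
Lemma betti_value_isolated J L i : (forall s, s <= k.+1 -> L s = toplev J s) ->
  betti_value k L 0 i = (i == weight J) * isolated_betti J.
Proof.
move=> LE; rewrite /betti_value mul1n !big_ord_recr /=.
have Lk : L k.+1 = top J n by rewrite LE // /toplev ltnn.
have Lt t : t <= k -> L t = top J t by move=> tk; rewrite LE ?(leqW tk) // /toplev tk.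
rewrite (eq_bigr (fun t : 'I_k => top J t.+1 - t)); last by move=> t _; rewrite Lt.
have -> : \sum_(t < k) (top J t.+1 - t) = #|[set j in J | j < k]|.
  rewrite (big_ord_widen n (fun t => top J t.+1 - t)) ?(ltnW kn) //.
  rewrite -sum1dep_card [in RHS]big_mkcondl; apply: eq_bigr => j _.
  have [jJ|jJ] := boolP (j \in J); first by rewrite topS_in // subSnn.
  by rewrite topS_notin //; apply/eqP; rewrite subn_eq0 top_le.
rewrite big1 ?mul1n; last first.
  move=> t _; have tn := ltn_trans (ltn_ord t) kn.
  rewrite !Lt ?(ltnW (ltn_ord t)) //; have := top_le J t.
  have [tJ|tJ] := boolP (Ordinal tn \in J).
    by rewrite (topS_in tJ) subSnn => tt; rewrite subSn //= bin0.
  by rewrite (topS_notin tJ) subnn /= -subn_eq0 => /eqP->.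
rewrite Lk Lt // /weight /isolated_betti; congr (_ * _).
case: ltnP => km; last first.
  by rewrite top_small // subnn; move: km; rewrite -subn_eq0 => /eqP ->.
have km' := leq_ltn_trans (top_le J k) km.
have e1 : top J n - top J k = (top J n - top J k - 1).+1 by lia.
have e2 : top J n - k = (top J n - k - 1).+1 by lia.
by rewrite [in LHS]e1 [in LHS]e2.
Qed.

Lemma isolated_card J : isolated J ->
  #|[set j in J | j < k]| + (k < top J n) = #|J|.
Proof.
case/andP => _ /forall_inP iso; rewrite -(cardsID [set j : 'I_n | j < k] J).
congr (_ + _); first by apply: eq_card => j; rewrite !inE.
have [km|mk] := ltnP k (top J n); last first.
  apply/esym/eqP; rewrite cards_eq0; apply/eqP/setP => j; rewrite !inE.
  apply/negP => /andP[/negP jk jJ]; case: jk.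
  exact: leq_trans (leq_top_n jJ) mk.
apply/esym/eqP/cards1P.
have : (top J n).-1 < top J n by rewrite (ltn_predK km).
case/ltn_top => j jJ /andP[mj _]; have jm := leq_top_n jJ; exists j.
apply/setP => l; rewrite !inE; apply/andP/eqP => [[lk lJ]|->].
  by have := iso l lJ; rewrite (negPf lk) => /eqP lm; apply/val_inj => /=; lia.
by rewrite jJ; split=> //; lia.
Qed.

Lemma dual_isolatedE J :
  (dual_isolated1 k J = isolated J && (top J n <= k.+1)) *
  (dual_isolated2 k J = isolated J && (k.+1 < top J n)).
Proof.
rewrite /dual_isolated1 /dual_isolated2 /isolated -top_last.
have [->|J0] := eqVneq J set0; rewrite //=; split.
  apply/forall_inP/andP => [h|[/forall_inP h mk] j jJ]; last first.
    exact: leq_trans (leq_top_n jJ) mk.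
  have mk : top J n <= k.+1 by apply/bigmax_leqP => j /andP[/h].
  split=> //; apply/forall_inP => j jJ.
  by have := h j jJ; have := leq_top_n jJ; lia.
rewrite top_le_n andbT; case: (ltnP k.+1 _) => mk; rewrite ?andbF ?andbT //.
apply: eq_forallb => j; case: (j \in J) => //=.
by case: (j.+1 == _); rewrite ?orbT ?orbF.
Qed.

Lemma mem_dual_iso1 J i : 0 < i ->
  (J \in dual_iso1 n k (i - 1)) =
  [&& isolated J, top J n <= k.+1 & weight J == i].
Proof.
move=> i0; rewrite inE dual_isolatedE -andbA; case: (boolP (isolated J)) => //= iJ.
case: leqP => //= mk; rewrite /dwt1 /weight; have := isolated_card iJ.
have : 0 < #|J| by rewrite card_gt0; case/andP: iJ.
by case: (ltnP k (top J n)) => /=; lia.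
Qed.

Lemma mem_dual_iso2 J i : 0 < i ->
  (J \in dual_iso2 n k (i - 1)) =
  [&& isolated J, k.+1 < top J n & weight J == i].
Proof.
move=> i0; rewrite inE dual_isolatedE -andbA; case: (boolP (isolated J)) => //= iJ.
case: ltnP => //= mk; rewrite /dwt2 /weight -top_last; have := isolated_card iJ.
have : 0 < #|J| by rewrite card_gt0; case/andP: iJ.
by case: (ltnP k (top J n)) => /=; lia.
Qed.

Lemma mem_dual_iso J i : 0 < i ->
  (J \in dual_iso n k (i - 1)) = isolated J && (weight J == i).
Proof.
move=> i0; rewrite inE mem_dual_iso1 // mem_dual_iso2 //.
by case: isolated; case: ltnP => //=; rewrite ?orbF.
Qed.

Lemma isolated_betti1 J : top J n <= k.+1 -> isolated_betti J = 1.
Proof.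
rewrite /isolated_betti => mk; case: ltnP => // km.
by rewrite (_ : top J n - k - 1 = 0) ?bin0 //; lia.
Qed.

Lemma isolated_betti2 J : isolated J -> k.+1 < top J n ->
  isolated_betti J =
  'C(elt J #|J| - elt J (#|J| - 1) - 1, k - elt J (#|J| - 1)).
Proof.
move=> iJ mk; rewrite /isolated_betti (ltnW mk) -top_last.
have J0 : 0 < #|J| by rewrite card_gt0; case/andP: iJ.
have -> : elt J (#|J| - 1) = top J k.
  apply/esym/top_elt; rewrite ?leq_subr //; last first.
    by rewrite subn1 prednK // -top_last => _; apply: ltnW.
  case E : (#|J| - 1) => [//|a]; have aJ : a < #|J| by lia.
  have [j jJ Ej] := elt_mem aJ; rewrite Ej.
  case/andP: iJ => _ /forall_inP/(_ j jJ)/orP[//|].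
  by rewrite top_last -Ej; have := @elt_ltn _ J a.+1 #|J|; lia.
have := top_le J k => tk.
by rewrite -bin_sub; [congr 'C(_, _)|]; lia.
Qed.

(** This recovers [J] from its level counts. With elements numbered from 1, an element [j <= k] is
    detected by [L j = j]; all larger ones share the level [k.+1], whose count is then the largest
    element. *)
Definition level_set L : {set 'I_n} :=
  [set j : 'I_n | L (minn j.+1 k.+1) == j.+1].

Lemma level_setK J L : isolated J -> (forall s, s <= k.+1 -> L s = toplev J s) ->
  level_set L = J.
Proof.
case/andP => _ /forall_inP iso LE; apply/setP => j; rewrite inE.
rewrite LE ?geq_minr // /toplev; have [jk|kj] := ltnP j k.
  rewrite (minn_idPl _) ?jk; last exact: leqW.
  have [jJ|jJ] := boolP (j \in J); first by rewrite topS_in ?eqxx.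
  by rewrite topS_notin //; have := top_le J j; lia.
rewrite (minn_idPr _) ?ltnS // ltnn; apply/eqP/idP => [E|jJ]; last first.
  by have := iso j jJ; rewrite ltnNge kj => /eqP.
have : j < top J n by rewrite E.
case/ltn_top => j' j'J /andP[jj' _]; have := leq_top_n j'J; rewrite E ltnS => j'j.
by rewrite (_ : j = j') //; apply/val_inj/eqP; rewrite eqn_leq jj'.
Qed.

Lemma ncompositions_neq0 e w :
  ncompositions e w != 0 -> (e = 0 /\ w = 0) \/ (0 < w <= e).
Proof. by case: e w => [|e] [|w] //=; rewrite -?lt0n ?bin_gt0; [left|right]. Qed.

(** Every factor is non-zero, which forces the counts up to [k] to stay constant or to jump from at
    most [t] to exactly [t.+1]. Such a function is [top] of the set of its jumps. *)
Lemma betti_value_neq0 L e i :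
    {homo L : s s' / s <= s'} -> (forall s, L s <= n) -> (e = 0 -> L 0 = 0) ->
    0 < i -> betti_value k L e i != 0 ->
  [/\ e = 0, isolated (level_set L) &
      forall s, s <= k.+1 -> L s = toplev (level_set L) s].
Proof.
move=> Lhomo Ln L0e i0; rewrite /betti_value !muln_eq0 !negb_or eqb0 negbK.
case/and3P=> /eqP iE e0 p0.
have {}e0 : e = 0 by case: e e0 {L0e}.
have L0 := L0e e0.
(* Either the class is empty and needs nothing, or its need is positive and at most its size. *)
have dich t : t <= k ->
    (L t.+1 = L t /\ L t.+1 <= t) \/ (t < L t.+1 /\ L t <= t).
  rewrite -ltnS => tk; have : ncompositions (L t.+1 - L t) (L t.+1 - t) != 0.
    by apply: contraNneq p0 => E; rewrite (bigD1 (Ordinal tk)) //= E.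
  by move/ncompositions_neq0; have := Lhomo t t.+1 (leqnSn t); lia.
have Lle t : t <= k -> L t <= t by move/dich; lia.
set J := level_set L.
have topL s : s <= k -> top J s = L s.
  elim: s => [|s IH] sk; first by rewrite L0; apply/eqP; rewrite -leqn0 top_le.
  have sn : s < n by lia.
  have [sJ|sJ] := boolP (Ordinal sn \in J).
    rewrite (topS_in sJ); move: sJ; rewrite inE /= (minn_idPl _) => [/eqP->//|].
    exact: leqW.
  rewrite (topS_notin sJ) IH ?(ltnW sk) //; move: sJ; rewrite inE /= (minn_idPl _).
    by have := dich s (ltnW sk); have := Lle _ sk; lia.
  exact: leqW.
have big (j : 'I_n) : k <= j -> (j \in J) = (L k.+1 == j.+1).
  by move=> kj; rewrite inE (minn_idPr _).
have topn : top J n = L k.+1.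
  have [Lk|kL] := leqP (L k.+1) k.
    have E : L k.+1 = L k by have := dich k (leqnn k); lia.
    rewrite E -(topL k) //; apply/esym/top_small/bigmax_leqP => j /andP[jJ _].
    by rewrite ltnNge; apply/negP => kj; move: jJ; rewrite big //; lia.
  have Ln1 : (L k.+1).-1 < n by have := Ln k.+1; lia.
  have jJ : Ordinal Ln1 \in J by rewrite big /= ?(ltn_predK kL) //; lia.
  apply/eqP; rewrite eqn_leq; apply/andP; split.
    apply/bigmax_leqP => j /andP[jJ' _]; have [jk|kj] := ltnP j k; first by lia.
    by move: jJ'; rewrite big // => /eqP ->.
  by have := leq_top_n jJ; rewrite /= ; lia.
have LE s : s <= k.+1 -> L s = toplev J s.
  rewrite leq_eqVlt /toplev => /orP[/eqP->|]; first by rewrite ltnn topn.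
  by rewrite ltnS => sk; rewrite sk topL.
split=> //; apply/andP; split.
  apply/negP => /eqP J0; have top0 s : top J s = 0.
    by rewrite J0 /top big1 // => j; rewrite inE.
  (* With [J] empty all needs would vanish, against [0 < i]. *)
  move: i0; rewrite iE big1 // => t _; apply/eqP; rewrite subn_eq0.
  by rewrite LE /toplev ?top0 ?ltn_ord //; case: ifP.
apply/forall_inP => j jJ; have [//|kj] := ltnP j k; rewrite topn.
by move: jJ; rewrite big // eq_sym.
Qed.

End IsolatedBetti.

(** * Permutation orbits of degrees and total Betti numbers *)

Section Orbits.

Local Open Scope nat_scope.

Variables (n k : nat).
Hypothesis kn : k < n.
Implicit Types (J : {set 'I_n}) (b c : 'X_{1..n}).

Lemma count_mnm b (P : pred nat) : count P b = #|[set l | P (b l)]|.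
Proof.
rewrite -[in LHS](map_tnth_enum b) count_map cardE -size_filter.
by congr size; rewrite [RHS]/enum_mem -enumT; apply: eq_filter => l; rewrite /= inE.
Qed.

Lemma perm_lev b c s : perm_eq b c -> lev b s = lev c s.
Proof.
by move/seq.permP/(_ (fun x => n.+1 - s <= x)); rewrite !count_mnm.
Qed.

Lemma perm_stray b c : perm_eq b c -> #|stray k b| = #|stray k c|.
Proof.
by move/seq.permP/(_ (fun x => (x != 0) && ~~ (n - k <= x <= n))); rewrite !count_mnm.
Qed.

Lemma mnm_permP b c : reflect (exists s : 'S_n, b = mnm_perm s c) (perm_eq b c).
Proof.
apply: (iffP tuple_permP) => -[s E]; exists s.
  apply/mnmP => l; rewrite mnmE !(mnm_nth 0) -!tnth_nth.
  have /(congr1 (fun x => nth 0 x l)) := E; rewrite -!tnth_nth => ->.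
  by rewrite tnth_mktuple.
rewrite E /mnm_perm /=; congr map.
Qed.

Lemma lev0_stray b : #|stray k b| = 0 -> lev b 0 = 0.
Proof.
move=> /eqP; rewrite cards_eq0 => /eqP/setP st; apply/eqP; rewrite cards_eq0.
by apply/eqP/setP => l; have := st l; rewrite !inE; lia.
Qed.

(** Without stray variables the exponents are 0 or between [n - k] and [n]; consecutive level counts
    differ by the multiplicity of one such value, and 0 takes the remaining places. *)
Lemma perm_of_levels b c : #|stray k b| = 0 -> #|stray k c| = 0 ->
  (forall s, s <= k.+1 -> lev b s = lev c s) -> perm_eq b c.
Proof.
move=> sb sc E.
have cnt (d : 'X_{1..n}) v : #|stray k d| = 0 ->
    count_mem v d = if v == 0 then n - lev d k.+1 else
      if n - k <= v <= n then lev d (n - v).+1 - lev d (n - v) else 0.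
  move=> /eqP; rewrite cards_eq0 => /eqP/setP st; rewrite count_mnm.
  have {}st l : (d l != 0) -> n - k <= d l <= n.
    by move=> h; have := st l; rewrite !inE h => /negbFE.
  case: eqP => [->|v0].
    have -> : n - lev d k.+1 = #|~: [set l | n.+1 - k.+1 <= d l]|.
      by rewrite cardsCs setCK card_ord.
    by apply: eq_card => l; rewrite !inE /=; have := st l; lia.
  case: ifP => vk; last first.
    apply/eqP; rewrite cards_eq0; apply/eqP/setP => l; rewrite !inE /=.
    by apply/negP => /eqP E'; have := st l; rewrite E' vk; move/eqP: v0 => -> /(_ isT).
  rewrite /lev -[X in _ - X](_ : #|[set l | n.+1 - (n - v).+1 <= d l] :&:
      [set l | n.+1 - (n - v) <= d l]| = _); last first.
    by apply: eq_card => l; rewrite !inE; lia.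
  by rewrite -cardsD; apply: eq_card => l; rewrite !inE /=; lia.
apply/allP => v _; rewrite /= !cnt // E //; case: ifP => // _; case: ifP => // vk.
by rewrite !E //; lia.
Qed.

Section Blocks.

Variable J : {set 'I_n}.
Hypothesis isoJ : isolated k J.

(** The final block, from the largest element to [n], gets index [#|J|] and exponent 0; it may be
    empty. *)
Let value a := if a < #|J| then lam n k (elt J a.+1) else 0.

Let bdeg_value (l : 'I_n) a : a <= #|J| -> elt J a <= l < elt J a.+1 ->
  bdeg k J l = value a.
Proof.
move=> aJ aP; rewrite /value; case: ltnP => [aJ'|Ja]; first exact: bdeg_block.
have E : a = #|J| by apply/eqP; rewrite eqn_leq aJ.
by rewrite bdeg_out // -E; case/andP: aP.
Qed.

(** Only the last element of [J] may exceed [k], so [lam] does not reach its constant part twice.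
    Distinct blocks thus carry distinct exponents. *)
Let value_lt (a c : nat) : a < c -> c <= #|J| -> value c < value a.
Proof.
move=> ac cJ; have aJ := leq_trans ac cJ; rewrite /value aJ.
have En := elt_le_n aJ.
case: (ltnP c #|J|) => cJ'; last by rewrite /lam; case: ifP; lia.
have lt : elt J a.+1 < elt J c.+1 by apply: elt_ltn.
have [j jJ Ej] := elt_mem aJ.
have : elt J a.+1 <= k.
  case/andP: isoJ => _ /forall_inP/(_ j jJ); rewrite Ej => /orP[//|/eqP E].
  by have := elt_leq cJ' (leqnn _); rewrite -top_last; lia.
by move=> ak; have := elt_le_n cJ'; rewrite /lam ak; case: (leqP (elt J c.+1) k); lia.
Qed.

Let value_inj (a c : nat) : a <= #|J| -> c <= #|J| -> value a = value c -> a = c.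
Proof.
move=> aJ cJ E; case: (ltngtP a c) => // h; last by have := value_lt h aJ; lia.
by have := value_lt h cJ; lia.
Qed.

Let block_all (l : 'I_n) : exists2 a, a <= #|J| & elt J a <= l < elt J a.+1.
Proof.
have [tl|lt] := leqP (elt J #|J|) l; first by exists #|J|; rewrite // tl elt_last /=.
by have [a aJ aP] := elt_block lt; exists a => //; apply: ltnW.
Qed.

Let count_value a : a <= #|J| ->
  count_mem (value a) (bdeg k J) = elt J a.+1 - elt J a.
Proof.
move=> aJ; rewrite count_mnm.
have En : elt J a.+1 <= n.
  by move: aJ; rewrite leq_eqVlt => /orP[/eqP->|/elt_le_n//]; rewrite elt_last.
have Ea := elt_leS aJ.
rewrite -[in RHS](card_ltn_ord En) -[X in _ - X](card_ltn_ord (leq_trans Ea En)).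
rewrite -[X in _ - X](_ : #|[set l : 'I_n | l < elt J a.+1] :&:
  [set l : 'I_n | l < elt J a]| = _); last by apply: eq_card => l; rewrite !inE; lia.
rewrite -cardsD; apply: eq_card => l; rewrite !inE /= -leqNgt.
apply/eqP/idP => [E|aP]; last exact: bdeg_value.
have [c cJ cP] := block_all l; rewrite (bdeg_value cJ cP) in E.
by rewrite -(value_inj cJ aJ E).
Qed.

(** Each step absorbs a binomial into two factorials by [bin_fact], so the product of binomials is a
    multinomial coefficient in the block lengths. *)
Let telescope t : t <= #|J| ->
  (\prod_(1 <= a < t.+1) 'C(elt J a.+1, elt J a)) *
  \prod_(0 <= a < t.+1) (elt J a.+1 - elt J a)`! = (elt J t.+1)`!.
Proof.
elim: t => [|t IH] tJ; first by rewrite big_geq // big_nat1 elt0 subn0 mul1n.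
rewrite big_nat_recr // [X in _ * X]big_nat_recr //=.
rewrite mulnACA IH ?(ltnW tJ) // -(bin_fact (elt_leS tJ)).
by rewrite mulnC -mulnA [X in _ * X]mulnC.
Qed.

Lemma size_permutations_bdeg :
  size (permutations (bdeg k J)) =
  \prod_(1 <= a < #|J|.+1) 'C(elt J a.+1, elt J a).
Proof.
(* The exponent 0 stays in [r] even when the final block is empty. *)
pose r := [seq value a | a <- index_iota 0 #|J|.+1].
have ur : uniq r.
  rewrite map_inj_in_uniq ?iota_uniq // => a c.
  by rewrite !mem_index_iota /= !ltnS; apply: value_inj.
have sr : {subset (bdeg k J : seq nat) <= r}.
  move=> v; rewrite -[X in v \in X](map_tnth_enum (bdeg k J)) => /mapP[l _ ->].
  have [a aJ aP] := block_all l; rewrite -/(bdeg k J l) (bdeg_value aJ aP).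
  by apply: map_f; rewrite mem_index_iota ltnS.
have := size_permutations_multinomial ur sr.
rewrite big_map (eq_big_nat _ _ (F2 := fun a => (elt J a.+1 - elt J a)`!)); last first.
  by move=> a /= aJ; rewrite count_value.
rewrite size_tuple -[in RHS](elt_last J) -(telescope (leqnn _)) => /eqP.
by rewrite eqn_pmul2r => [/eqP//|]; apply: prodn_gt0 => a; apply: fact_gt0.
Qed.

End Blocks.

Section TotalBetti.

Variables (K : fieldType) (rk : nat -> nat).
Variables (deg : forall i, 'I_(rk i) -> 'X_{1..n}).
Variables (D : forall i, 'M[K]_(rk i.+1, rk i)).
Hypothesis resD : kresolution (in_skeleton k) deg D.

Lemma betti_isolated J i b : isolated k J -> perm_eq b (bdeg k J) ->
  #|[set p : 'I_(rk i) | deg p == b]| = (i == weight k J) * isolated_betti k J.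
Proof.
move=> iJ pb; rewrite (skeleton_multigraded_betti _ _ _ resD) // (perm_stray pb).
rewrite stray_bdeg // cards0; apply: betti_value_isolated => // s sk.
by rewrite (perm_lev _ pb) lev_bdeg.
Qed.

Lemma betti_neq0 i b : 0 < i -> #|[set p : 'I_(rk i) | deg p == b]| != 0 ->
  let J := level_set n k (lev b) in
  [/\ isolated k J, weight k J = i & perm_eq b (bdeg k J)].
Proof.
move=> i0 c0 J; move: (c0); rewrite (skeleton_multigraded_betti _ _ _ resD) //.
move/(betti_value_neq0 kn (@lev_leq n b) (@lev_le_n n b) (@lev0_stray b) i0).
case=> s0 iJ LE; have pb : perm_eq b (bdeg k J).
  by apply: perm_of_levels; rewrite ?stray_bdeg ?cards0 // => s sk; rewrite LE ?lev_bdeg.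
split=> //; move: c0; rewrite (betti_isolated _ iJ pb).
by case: (i =P weight k J) => [->|].
Qed.

(** Basis vectors are sorted by the set [F p] read off from their level counts. Those attached to
    [J] are spread over the orbit of [bdeg k J], with the same multiplicity in each degree of it. *)
Lemma rank_sum i : 0 < i ->
  rk i = \sum_(J in dual_iso n k (i - 1))
    (\prod_(1 <= a < #|J|.+1) 'C(elt J a.+1, elt J a)) * isolated_betti k J.
Proof.
move=> i0; pose F p := level_set n k (lev (@deg i p)).
have Fp p : [/\ isolated k (F p), weight k (F p) = i & perm_eq (deg p) (bdeg k (F p))].
  apply: betti_neq0 => //; rewrite -lt0n; apply/card_gt0P; exists p.
  by rewrite inE.
rewrite -[LHS]card_ord -sum1_card.
rewrite (partition_big F (fun J => J \in dual_iso n k (i - 1))) => [|p _]; last first.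
  by rewrite /= mem_dual_iso //; have [-> -> _] := Fp p; rewrite eqxx.
apply: eq_bigr => J; rewrite mem_dual_iso // => /andP[iJ /eqP wJ].
rewrite -size_permutations_bdeg // sum1dep_card.
transitivity (\sum_(s <- permutations (bdeg k J))
    #|[set p : 'I_(rk i) | deg p == s :> seq nat]|).
  under eq_bigr => s _ do rewrite -sum1dep_card.
  rewrite (exchange_big_dep xpredT) //= -sum1dep_card big_mkcond; apply: eq_bigr => p _.
  rewrite sum1_count (eq_count (a2 := pred1 (deg p : seq nat))); last first.
    by move=> s; rewrite /= eq_sym.
  rewrite count_uniq_mem ?permutations_uniq //.
  rewrite mem_permutations; have [_ _ pp] := Fp p.
  case: eqP => [<-|ne]; first by rewrite pp.
  case: (boolP (perm_eq _ _)) => // pJ; case: ne; apply: level_setK => // s sk.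
  by rewrite (perm_lev _ pJ) lev_bdeg.
rewrite (eq_big_seq (fun=> isolated_betti k J)) ?big_const_seq.
  by rewrite count_predT iter_addn_0 mulnC.
move=> s; rewrite mem_permutations => ps.
have sz : size s == n by rewrite (perm_size ps) size_tuple.
pose b : 'X_{1..n} := Multinom (Tuple sz).
have pb : perm_eq b (bdeg k J) by [].
have := betti_isolated i iJ pb; rewrite wJ eqxx mul1n => <-.
by apply: eq_card => p; rewrite !inE.
Qed.

Lemma total_betti i : 0 < i ->
  rk i = \sum_(J in dual_iso1 n k (i - 1)) beta1 J +
         \sum_(J in dual_iso2 n k (i - 1)) beta2 k J.
Proof.
move=> i0; rewrite rank_sum // (bigID (fun J => top J n <= k.+1)) /=.
congr (_ + _); apply: eq_big => J; rewrite ?mem_dual_iso ?mem_dual_iso1 ?mem_dual_iso2 //.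
- by case: (isolated k J); case: (_ <= _) => //=; rewrite ?andbF ?andbT.
- by case/andP=> /andP[iJ _] mk; rewrite isolated_betti1 // muln1.
- by rewrite -ltnNge; case: (isolated k J); case: (_ < _) => //=; rewrite ?andbF ?andbT.
by case/andP=> /andP[iJ _]; rewrite -ltnNge => mk; rewrite isolated_betti2.
Qed.

End TotalBetti.

End Orbits.

(** * Existence of a minimal resolution *)

Section Subspaces.

Variable K : fieldType.

Definition subspace r (W : 'rV[K]_r -> Prop) : Prop :=
  W 0 /\ forall a u v, W u -> W v -> W (a *: u + v).

(** A row space inside [W] is enlarged by a vector of [W] outside it, as long as there is one; the
    rank bounds the number of enlargements. *)
Lemma subspace_matrix r (W : 'rV[K]_r -> Prop) : subspace W ->
  exists A : 'M[K]_r, forall v : 'rV_r, W v <-> (v <= A)%MS.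
Proof.
move=> sW.
suff H m (A : 'M[K]_r) : (r - \rank A < m)%N -> (forall v : 'rV_r, (v <= A)%MS -> W v) ->
    exists A : 'M[K]_r, forall v : 'rV_r, W v <-> (v <= A)%MS.
  by apply: (H r.+1 0) => [|v];
    [rewrite mxrank0 subn0|rewrite submx0 => /eqP ->; case: sW].
elim: m A => // m IH A Am WA.
have [E|nE] := classic (forall v : 'rV_r, W v -> (v <= A)%MS).
  by exists A => v; split; [apply: E|apply: WA].
have [v nv] := not_all_ex_not _ _ nE.
have [Wv vA] := imply_to_and _ _ nv; move/negP: vA => vA.
apply: (IH (A + v)%MS); last first.
  move=> x /sub_addsmxP[[u1 u2] /= ->].
  rewrite -[u1 *m A]scale1r; case: (sW) => _; apply; first by apply: WA; rewrite submxMl.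
  by rewrite [u2]mx11_scalar mul_scalar_mx -[_ *: v]addr0; case: (sW) => W0; apply.
have lt : (A < A + v)%MS.
  rewrite ltmxE addsmxSl /=; apply: contra vA => h; apply: submx_trans h.
  exact: addsmxSr.
have := rank_ltmx lt; have := rank_leq_row A; have := rank_leq_row (A + v)%MS; lia.
Qed.

End Subspaces.

Section MinimalGenerators.

Variables (K : fieldType) (n N r : nat) (W : 'X_{1..n} -> 'rV[K]_r -> Prop).

Definition mnm_trunc (c : 'X_{1..n}) : 'X_{1..n} := [multinom minn (c l) N | l < n].

Hypothesis Wsub : forall c, subspace (W c).
Hypothesis Wtrunc : forall c v, W c v -> W (mnm_trunc c) v.

Definition generates r' (dg : 'I_r' -> 'X_{1..n}) (D : 'M[K]_(r', r)) : Prop :=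
  [/\ forall p, W (dg p) (row p D),
      forall c v, W c v -> exists2 w, supported dg c w & v = w *m D
    & forall p l, (dg p l <= N)%N].

Definition irredundant r' (dg : 'I_r' -> 'X_{1..n}) (D : 'M[K]_(r', r)) : Prop :=
  forall w c p, supported dg c w -> w *m D = 0 -> dg p = c -> w 0 p = 0.

(** Spanning rows are taken for [W] in each of the finitely many degrees of the box; truncation
    carries every other degree into the box. *)
Lemma exists_generators : exists r' (dg : 'I_r' -> 'X_{1..n}) D, generates dg D.
Proof.
pose X := ({ffun 'I_n -> 'I_N.+1} * 'I_r)%type.
pose mn (f : {ffun 'I_n -> 'I_N.+1}) : 'X_{1..n} := [multinom f l : nat | l < n].
have /choice_function[A AP] : forall f, exists A : 'M[K]_r,
    forall v : 'rV_r, W (mn f) v <-> (v <= A)%MS.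
  by move=> f; apply: subspace_matrix.
pose x (p : 'I_#|{: X}|) : X := enum_val p.
exists #|{: X}|, (fun p => mn (x p).1), (\matrix_p row (x p).2 (A (x p).1)); split.
- by move=> p; rewrite rowK; apply/AP/row_sub.
- move=> c v /Wtrunc Wv.
  pose f : {ffun 'I_n -> 'I_N.+1} := [ffun l => inord (minn (c l) N)].
  have fE : mn f = mnm_trunc c.
    by apply/mnmP => l; rewrite !mnmE ffunE inordK // ltnS geq_minr.
  move: Wv; rewrite -fE => /AP/submxP[u ->].
  exists (\row_p (if (x p).1 == f then u 0 (x p).2 else 0)).
    move=> p; rewrite mxE; case: ((x p).1 =P f) => [-> _|]; last by rewrite eqxx.
    by rewrite fE; apply/mnm_lepP => l; rewrite mnmE geq_minl.
  apply/rowP => j; rewrite !mxE.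
  pose G (y : X) := (if y.1 == f then u 0 y.2 else 0) * A y.1 y.2 j.
  transitivity (\sum_(y : X) G y).
    rewrite -(pair_big xpredT xpredT (fun g i => G (g, i))) /= (bigD1 f) //=.
    rewrite [X in _ = _ + X]big1 ?addr0 => [|g /negPf gf]; last first.
      by apply: big1 => i _; rewrite /G /= gf mul0r.
    by apply: eq_bigr => i _; rewrite /G /= eqxx.
  rewrite (reindex (fun p : 'I_#|{: X}| => enum_val p)); last first.
    exact/onW_bij/enum_val_bij.
  by apply: eq_bigr => p _; rewrite !mxE.
- by move=> p l; rewrite mnmE -ltnS.
Qed.

Lemma exists_irredundant_generators :
  exists r' (dg : 'I_r' -> 'X_{1..n}) D, generates dg D /\ irredundant dg D.
Proof.
have [r' [dg [D gD]]] := exists_generators.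
elim: r' dg D gD => [|r' IH] dg D gD; first by exists 0%N, dg, D; split=> // w c [].
have [iD|] := classic (irredundant dg D); first by exists r'.+1, dg, D.
move=> /not_all_ex_not[w].
move=> /not_all_ex_not[c].
move=> /not_all_ex_not[p] h.
have [wc {}h] := imply_to_and _ _ h.
have [wD {}h] := imply_to_and _ _ h.
have [pc /eqP wp] := imply_to_and _ _ h.
case: gD => gW gen gN; apply: (IH (fun q => dg (lift p q)) (row' p D)); split=> //.
  move=> q; have -> : row q (row' p D) = row (lift p q) D.
    by apply/rowP => j; rewrite !mxE.
  exact: gW.
(* The relation [w] eliminates [p] from [u]. If [u 0 p] is non-zero, [dg p] is at most [c'], hence
   so are the degrees occurring in [w]. *)
move=> c' v /gen[u uc ->]; pose u' := u - (u 0 p / w 0 p) *: w.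
have u'p : u' 0 p = 0 by rewrite !mxE divfK // subrr.
have u'c : supported dg c' u'.
  move=> q; rewrite !mxE; have [->|up] := eqVneq (u 0 p) 0.
    by rewrite mul0r mul0r subr0; apply: uc.
  have [wq|wq _] := eqVneq (w 0 q) 0; first by rewrite wq mulr0 subr0; apply: uc.
  by apply: lepm_trans (wc _ wq) _; rewrite -pc; apply: uc.
have u'D : u' *m D = u *m D by rewrite mulmxBl -scalemxAl wD scaler0 subr0.
exists (\row_q u' 0 (lift p q)); first by move=> q; rewrite mxE; apply: u'c.
rewrite -u'D; apply/rowP => j; rewrite !mxE (bigD1_ord p) //= u'p mul0r add0r.
by apply: eq_bigr => q _; congr (_ * _); rewrite !mxE.
Qed.

End MinimalGenerators.

Section ExistsResolution.

Variables (K : fieldType) (n N : nat) (inI : pred 'X_{1..n}).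
Hypothesis inI_le : forall c c', (c <= c')%MM -> inI c -> inI c'.
Hypothesis inI_trunc : forall c, inI c -> inI (mnm_trunc N c).
Hypothesis inI0 : ~~ inI 0%MM.

(** A stage holds one differential with the degrees of its source and target, which suffices to
    build the next one. *)
Record stage := Stage {
  srk : nat; sdeg : 'I_srk -> 'X_{1..n};
  srk' : nat; sdeg' : 'I_srk' -> 'X_{1..n};
  sD : 'M[K]_(srk', srk)
}.

Record extension (s : stage) := Extension {
  erk : nat; edeg : 'I_erk -> 'X_{1..n}; eD : 'M[K]_(erk, srk' s)
}.

Definition syzygies (s : stage) (c : 'X_{1..n}) (v : 'rV[K]_(srk' s)) : Prop :=
  supported (@sdeg' s) c v /\ v *m sD s = 0.

Definition minimal_extension s (e : extension s) : Prop :=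
  generates N (@syzygies s) (@edeg s e) (eD e) /\ irredundant (@edeg s e) (eD e).

Definition good_stage s : Prop :=
  (forall p l, (sdeg' (s := s) p l <= N)%N) /\ irredundant (@sdeg' s) (sD s).

Lemma exists_minimal_extension s : good_stage s -> exists e, @minimal_extension s e.
Proof.
case=> sN _; have [|c v [vc vD]|r' [dg [D h]]] :=
    @exists_irredundant_generators K n N (srk' s) (@syzygies s).
- move=> c; split=> [|a u v [uc uD] [vc vD]].
    by split; [move=> p; rewrite mxE eqxx|rewrite mul0mx].
  split; last by rewrite mulmxDl -scalemxAl uD vD scaler0 addr0.
  move=> p; rewrite !mxE; have [->|up _] := eqVneq (u 0 p) 0; last exact: uc.
  by rewrite mulr0 add0r; apply: vc.
- split=> // p /vc /mnm_lepP pc; apply/mnm_lepP => l.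
  by rewrite mnmE leq_min pc sN.
by exists (Extension dg D).
Qed.

Definition step (s : stage) : stage :=
  let e := epsilon (inhabits (@Extension s 0 (fun=> 0%MM) 0)) (@minimal_extension s) in
  Stage (@sdeg' s) (@edeg s e) (eD e).

Lemma stepP s : good_stage s ->
  generates N (@syzygies s) (@sdeg' (step s)) (sD (step s)) /\ good_stage (step s).
Proof.
move=> gs; rewrite /step.
have [gen irr] := epsilon_spec (inhabits (@Extension s 0 (fun=> 0%MM) 0)) _
  (exists_minimal_extension gs).
by split=> //; split=> //; case: gen.
Qed.

(** Starting from generators of I, each step takes irredundant generators of the syzygies of the
    previous differential. Their degrees stay in the box, so the truncation property is
    preserved. *)
Theorem exists_kresolution : exists (rk : nat -> nat)
  (deg : forall i, 'I_(rk i) -> 'X_{1..n}) (D : forall i, 'M[K]_(rk i.+1, rk i)),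
  kresolution inI deg D.
Proof.
(* The degree-[c] part of I inside that of R, which is one-dimensional. *)
pose W c (v : 'rV[K]_1) := v = 0 \/ inI c.
have [|c v|r1 [dg1 [D1 [gen1 irr1]]]] := @exists_irredundant_generators K n N 1 W.
- move=> c; split=> [|a u v [->|h] [->|h']]; [by left|left|right|right|right] => //.
  by rewrite scaler0 addr0.
- by case=> [->|/inI_trunc]; [left|right].
pose s0 := Stage (fun _ : 'I_1 => 0%MM) dg1 D1.
pose st i := iter i step s0.
have gs i : good_stage (st i).
  elim: i => [|i IH]; first by split=> //; case: gen1.
  by have [] := stepP IH.
have gen i := (stepP (gs i)).1.
exists (fun i => srk (st i)), (fun i => @sdeg (st i)), (fun i => sD (st i)).
case: gen1 => gW1 gen1 gN1; split.
- by exists (ord0 : 'I_1) => q; apply: ord1.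
- by [].
- case=> [|i] p q /= nz; first by apply/mnm_lepP => l; rewrite mnm0E.
  by have [/(_ p)[/(_ q) + _] _ _] := gen i; rewrite mxE; apply.
(* A row of a later differential is a syzygy in the degree of [p], so irredundance kills its entry
   at a vector of that degree; for the first differential the degree would be 0, which is not in
   I. *)
- case=> [|i] p q /= E.
    have := gW1 p; rewrite E => -[/rowP/(_ q)|]; first by rewrite !mxE.
    by rewrite (negPf inI0).
  have [/(_ p)[sp zp] _ _] := gen i; have := (gs i).2 _ _ q sp zp (esym E).
  by rewrite mxE.
- move=> i; apply/row_matrixP => p; rewrite row_mul row0.
  by have [/(_ p)[_ zp] _ _] := gen i.
- by move=> i c v vc vD; have [_ /(_ c v)[] // w] := gen i; exists w.
move=> c; split=> [Ic|[w wc]].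
  have [w wc E] := gen1 c 1%:M (or_intror Ic); exists w => //=.
  by rewrite -E; apply: contra_neq (oner_neq0 K) => /matrixP/(_ 0 0); rewrite !mxE.
move=> nz; apply/negPn/negP => nI; case/eqP: nz.
rewrite mulmx_sum_row big1 // => p _; have [->|wp] := eqVneq (w 0 p) 0.
  by rewrite scale0r.
case: (gW1 p) => [->|/(inI_le (wc p wp))]; first by rewrite scaler0.
by rewrite (negPf nI).
Qed.

End ExistsResolution.

(** * Homogeneous matrices and components of graded free modules *)

Section Components.

Variables (K : fieldType) (n : nat).
Implicit Types (c m : 'X_{1..n}).

Lemma mcoeffMXE (f : {mpoly K[n]}) m c :
  (f * 'X_[m])@_c = if (m <= c)%MM then f@_(c - m) else 0.
Proof.
case: ifP => [mc|/negP mc].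
  by rewrite -{1}(submK mc) addmC mcoeffMX.
apply/eqP; rewrite mcoeff_eq0 (perm_mem (msuppMX _ _)).
apply/negP => /mapP[m' _ E]; case: mc; rewrite E; apply/mnm_lepP => l.
by rewrite mnmDE leq_addr.
Qed.

Section Row.

Variables (r : nat) (dg : 'I_r -> 'X_{1..n}).

(** Monomial subtraction is truncated, hence the guard [dg p <= c]. *)
Definition component (v : 'rV[{mpoly K[n]}]_r) c : 'rV[K]_r :=
  \row_p (if (dg p <= c)%MM then (v 0 p)@_(c - dg p) else 0).

Definition homogeneous_row c (w : 'rV[K]_r) : 'rV[{mpoly K[n]}]_r :=
  \row_p (w 0 p *: 'X_[c - dg p]).

Lemma component_supported v c : supported dg c (component v c).
Proof. by move=> p; rewrite mxE; case: ifP => //; rewrite eqxx. Qed.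

Lemma component_inj u v : (forall c, component u c = component v c) -> u = v.
Proof.
move=> E; apply/rowP => p; apply/mpolyP => m.
have := congr1 (fun x : 'rV_r => x 0 p) (E (m + dg p)%MM); rewrite !mxE.
by rewrite addmK (_ : (_ <= _)%MM) //; apply/mnm_lepP => l; rewrite mnmDE leq_addl.
Qed.

Lemma component0 c : component 0 c = 0.
Proof. by apply/rowP => p; rewrite !mxE mcoeff0; case: ifP. Qed.

Lemma componentD u v c : component (u + v) c = component u c + component v c.
Proof. by apply/rowP => p; rewrite !mxE; case: ifP; rewrite ?addr0 // mcoeffD. Qed.

Lemma component_homogeneous c c' w : supported dg c w ->
  component (homogeneous_row c w) c' = if c == c' then w else 0.
Proof.
move=> wc; apply/rowP => p; rewrite !mxE mcoeffZ mcoeffX.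
have [wp|wp] := eqVneq (w 0 p) 0.
  by rewrite wp mul0r if_same; case: (c =P c') => _; rewrite ?mxE.
have pc := wc p wp; case: (c =P c') => [<-|ne].
  by rewrite pc eqxx mulr1.
rewrite mxE; case: ifP => // pc'.
have [E|_] := eqVneq (c - dg p)%MM (c' - dg p)%MM; last by rewrite mulr0.
by case: ne; rewrite -(submK pc) E submK.
Qed.

End Row.

Section Matrix.

Variables (r r' : nat) (dr : 'I_r -> 'X_{1..n}) (dc : 'I_r' -> 'X_{1..n}).

Definition homogeneous_mx (M : 'M[{mpoly K[n]}]_(r, r')) (D : 'M[K]_(r, r')) : Prop :=
  forall p q, M p q = D p q *: 'X_[dr p - dc q] /\ (D p q != 0 -> (dc q <= dr p)%MM).

Definition coef_mx (M : 'M[{mpoly K[n]}]_(r, r')) : 'M[K]_(r, r') :=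
  \matrix_(p, q) (if (dc q <= dr p)%MM then (M p q)@_(dr p - dc q) else 0).

Lemma coef_mxP (M : 'M[{mpoly K[n]}]_(r, r')) :
  (forall p q m, m \in msupp (M p q) -> dr p = (m + dc q)%MM) ->
  homogeneous_mx M (coef_mx M).
Proof.
move=> hM p q; split; last by rewrite mxE; case: ifP => //; rewrite eqxx.
apply/mpolyP => m; rewrite mcoeffZ mcoeffX mxE.
have [mM|mM] := boolP (m \in msupp (M p q)).
  rewrite (hM _ _ _ mM) addmK eqxx mulr1 (_ : (_ <= _)%MM) //.
  by apply/mnm_lepP => l; rewrite mnmDE leq_addl.
rewrite (memN_msupp_eq0 mM); case: eqP => [->|]; rewrite ?mulr0 // mulr1.
by rewrite (memN_msupp_eq0 mM); case: ifP.
Qed.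

Variables (M : 'M[{mpoly K[n]}]_(r, r')) (D : 'M[K]_(r, r')).
Hypothesis hM : homogeneous_mx M D.

(** The monomials of degrees [c - dr p] and [dr p - dc q] multiply to that of degree [c - dc q], so
    only the scalars of [D] remain. *)
Lemma component_mulmx v c : component dc (v *m M) c = component dr v c *m D.
Proof.
apply/rowP => q; rewrite !mxE raddf_sum /=.
have [qc|qc] := boolP (dc q <= c)%MM; last first.
  apply/esym/big1 => p _; rewrite mxE; have [_ hD] := hM p q.
  have [->|/hD qp] := eqVneq (D p q) 0; first by rewrite mulr0.
  by case: ifP => [pc|_]; [case/negP: qc; apply: lepm_trans qp pc|rewrite mul0r].
apply: eq_bigr => p _; rewrite mxE; have [-> hD] := hM p q.
rewrite -scalerAr mcoeffZ mcoeffMXE; have [->|/hD qp] := eqVneq (D p q) 0.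
  by rewrite mul0r mulr0.
have -> : (dr p - dc q <= c - dc q)%MM = (dr p <= c)%MM.
  apply/mnm_lepP/mnm_lepP => h l; have := h l; rewrite !mnmBE;
    move/mnm_lepP: qp => /(_ l); move/mnm_lepP: qc => /(_ l); lia.
case: ifP => [pc|_]; last by rewrite mulr0 mul0r.
suff -> : (c - dc q - (dr p - dc q))%MM = (c - dr p)%MM by apply: mulrC.
apply/mnmP => l; rewrite !mnmBE.
by move/mnm_lepP: qp => /(_ l); move/mnm_lepP: pc => /(_ l); lia.
Qed.

Lemma supported_mulmx c w : supported dr c w -> supported dc c (w *m D).
Proof.
move=> wc q; apply: contraNT => qc; rewrite mxE big1 // => p _.
have [->|/wc pc] := eqVneq (w 0 p) 0; first by rewrite mul0r.
have [->|/(hM p q).2 qp] := eqVneq (D p q) 0; first by rewrite mulr0.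
by case/negP: qc; apply: lepm_trans qp pc.
Qed.

Lemma homogeneous_row_mulmx c w : supported dr c w ->
  homogeneous_row dr c w *m M = homogeneous_row dc c (w *m D).
Proof.
move=> wc; apply: (@component_inj _ dc) => c'; rewrite component_mulmx.
rewrite !component_homogeneous //; last exact: supported_mulmx.
by case: eqP => // _; rewrite mul0mx.
Qed.

(** Only the finitely many degrees in [s] carry a non-zero component of [v]; the homogeneous lifts
    of these components are added up. *)
Lemma image_components (v : 'rV[{mpoly K[n]}]_r') :
    (forall c, exists2 w, supported dr c w & component dc v c = w *m D) ->
  exists u, v = u *m M.
Proof.
move=> hv.
have /choice_function[f fP] : forall c, exists w,
    supported dr c w /\ component dc v c = w *m D.
  by move=> c; have [w] := hv c; exists w.
pose s := undup (flatten
  [seq [seq (m + dc p)%MM | m <- msupp (v 0 p)] | p <- enum 'I_r']).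
have sP c : c \notin s -> component dc v c = 0.
  move=> cs; apply/rowP => p; rewrite !mxE; case: ifP => // pc.
  apply: memN_msupp_eq0; apply: contra cs => h; rewrite mem_undup.
  apply/flattenP; exists [seq (m + dc p)%MM | m <- msupp (v 0 p)].
    by apply: map_f; rewrite mem_enum.
  by apply/mapP; exists (c - dc p)%MM => //; rewrite submK.
exists (\sum_(c <- s) homogeneous_row dr c (f c)).
apply: (@component_inj _ dc) => c; rewrite component_mulmx.
have -> : component dr (\sum_(c <- s) homogeneous_row dr c (f c)) c =
    \sum_(c' <- s) component dr (homogeneous_row dr c' (f c')) c.
  elim/big_ind2: _ => [|x1 x2 y1 y2 <- <-|//]; first exact: component0.
  exact: componentD.
rewrite (eq_bigr (fun c' => if c' == c then f c' else 0)); last first.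
  by move=> c' _; rewrite component_homogeneous //; case: (fP c').
have [cs|cs] := boolP (c \in s); last first.
  rewrite sP // big1_seq ?mul0mx // => c' /= c's.
  by case: eqP => // E; rewrite -E c's in cs.
rewrite (bigD1_seq c) ?undup_uniq //= eqxx big1 ?addr0; first by case: (fP c).
by move=> c' /negPf ->.
Qed.

End Matrix.

Section Exactness.

Variables (r2 r1 r0 : nat).
Variables (d2 : 'I_r2 -> 'X_{1..n}) (d1 : 'I_r1 -> 'X_{1..n}) (d0 : 'I_r0 -> 'X_{1..n}).
Variables (M2 : 'M[{mpoly K[n]}]_(r2, r1)) (M1 : 'M[{mpoly K[n]}]_(r1, r0)).
Variables (D2 : 'M[K]_(r2, r1)) (D1 : 'M[K]_(r1, r0)).
Hypotheses (hM2 : homogeneous_mx d2 d1 M2 D2) (hM1 : homogeneous_mx d1 d0 M1 D1).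

Lemma exact_components :
    (forall v : 'rV_r1, v *m M1 = 0 <-> exists w : 'rV_r2, v = w *m M2) ->
  D2 *m D1 = 0 /\ forall c (v : 'rV_r1), supported d1 c v -> v *m D1 = 0 ->
    exists2 w, supported d2 c w & v = w *m D2.
Proof.
move=> ex; split=> [|c v vc vD].
  apply/row_matrixP => p; rewrite row0 rowE.
  (* Row [p] of [D2] is the image of the basis vector [p], which is homogeneous of degree [d2 p]. *)
  have sp : supported d2 (d2 p) (delta_mx 0 p : 'rV[K]_r2).
    move=> q; rewrite mxE eqxx /=; case: (q =P p) => [-> _|_]; last by rewrite eqxx.
    exact: lepm_refl.
  have /ex : exists w, homogeneous_row d2 (d2 p) (delta_mx 0 p) *m M2 = w *m M2.
    by eexists.
  move/(congr1 (fun v => component d0 v (d2 p))).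
  rewrite (component_mulmx hM1) (component_mulmx hM2) component_homogeneous // eqxx.
  by rewrite mulmxA component0.
have : homogeneous_row d1 c v *m M1 = 0.
  rewrite (homogeneous_row_mulmx hM1) // vD; apply/rowP => p.
  by rewrite !mxE scale0r.
move/ex => [w /(congr1 (fun v => component d1 v c))].
rewrite component_homogeneous // eqxx (component_mulmx hM2) => E.
by exists (component d2 w c) => //; apply: component_supported.
Qed.

Lemma components_exact :
    D2 *m D1 = 0 ->
    (forall c (v : 'rV_r1), supported d1 c v -> v *m D1 = 0 ->
      exists2 w, supported d2 c w & v = w *m D2) ->
  forall v : 'rV_r1, v *m M1 = 0 <-> exists w : 'rV_r2, v = w *m M2.
Proof.
move=> DD ex v; split=> [vM|[w ->]].
  apply: (image_components hM2) => c; apply: ex; first exact: component_supported.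
  by rewrite -(component_mulmx hM1) vM component0.
apply: (@component_inj _ d0) => c; rewrite (component_mulmx hM1) (component_mulmx hM2).
by rewrite -mulmxA DD mulmx0 component0.
Qed.

End Exactness.

End Components.

(** * The skeleton ideal as a monomial ideal *)

Section SkeletonIdeal.

Variables (K : fieldType) (n k : nat).
Implicit Types (f : {mpoly K[n]}) (m c : 'X_{1..n}).

Definition gen_mnm (A : {set 'I_n}) : 'X_{1..n} :=
  [multinom if l \in A then (n - #|A| + 1)%N else 0%N | l < n].

Lemma gen_mnmP (A : {set 'I_n}) m :
  (gen_mnm A <= m)%MM = [forall (j | j \in A), n - #|A| + 1 <= m j]%N.
Proof.
apply/mnm_lepP/forall_inP => h l; last by rewrite mnmE; case: ifP => // /h.
by move=> lA; have := h l; rewrite mnmE lA.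
Qed.

Lemma prod_gen_mnm (A : {set 'I_n}) :
  (\prod_(j in A) 'X_j) ^+ (n - #|A| + 1) = 'X_[gen_mnm A] :> {mpoly K[n]}.
Proof.
rewrite -(big_morph (fun m => 'X_[m] : {mpoly K[n]}) (@mpolyXD _ _) (@mpolyX0 _ _)).
rewrite mpolyXn; congr 'X_[_]; apply/mnmP => l; rewrite mulmnE mnm_sumE mnmE.
rewrite big_mkcond (bigD1 l) //= mnm1E eqxx big1 ?addn0; last first.
  by move=> j jl; rewrite mnm1E (negPf jl); case: ifP.
by case: ifP; rewrite ?mul1n ?mul0n.
Qed.

Lemma in_skeleton_gen m :
  in_skeleton k m = [exists A : {set 'I_n},
    [&& A != set0, (#|A| <= k.+1)%N & (gen_mnm A <= m)%MM]].
Proof. by apply: eq_existsb => A; rewrite gen_mnmP. Qed.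

Lemma in_skeleton_le c c' : (c <= c')%MM -> in_skeleton k c -> in_skeleton k c'.
Proof.
rewrite !in_skeleton_gen => cc' /existsP[A /and3P[A0 Ak Ac]]; apply/existsP.
by exists A; rewrite A0 Ak (lepm_trans Ac cc').
Qed.

(** Since [A] is non-empty, no exponent of a generator exceeds [n]. *)
Lemma in_skeleton_trunc c : in_skeleton k c -> in_skeleton k (mnm_trunc n c).
Proof.
case/existsP=> A /and3P[A0 Ak /forall_inP Ac]; apply/existsP.
exists A; rewrite A0 Ak; apply/forall_inP => j /Ac h; rewrite mnmE leq_min h.
by have := ltn_ord j; move: A0; rewrite -card_gt0; move: #|_| => a; lia.
Qed.

Lemma in_skeleton0 : in_skeleton k (0%MM : 'X_{1..n}) = false.
Proof.
apply/existsP => -[A /and3P[/set0Pn[j jA] _ /forall_inP/(_ j jA)]].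
by rewrite mnm0E addn1.
Qed.

Lemma skeleton_idealP f :
  skeleton_ideal k f <-> forall m, m \in msupp f -> in_skeleton k m.
Proof.
split=> [[c ->] m|fI].
  move/msupp_sum_le/flattenP => [s /mapP[A]]; rewrite mem_filter.
  case/andP=> /andP[A0 Ak] _ ->; rewrite prod_gen_mnm (perm_mem (msuppMX _ _)).
  case/mapP => m' _ ->; rewrite in_skeleton_gen; apply/existsP; exists A.
  by rewrite A0 Ak; apply/mnm_lepP => l; rewrite mnmDE leq_addr.
rewrite [f]mpolyE big_seq; elim/big_ind: _ => [|_ _ [c ->] [c' ->]|m /fI].
- by exists (fun=> 0); rewrite big1 // => A _; rewrite mul0r.
- exists (fun A => c A + c' A); rewrite -big_split; apply: eq_bigr => A _ /=.
  by rewrite mulrDl.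
rewrite in_skeleton_gen => /existsP[A /and3P[A0 Ak Am]].
exists (fun B => if B == A then f@_m *: 'X_[m - gen_mnm A] else 0).
rewrite (bigD1 A) ?A0 //= eqxx prod_gen_mnm big1 ?addr0; last first.
  by move=> B /andP[_ /negPf ->]; rewrite mul0r.
by rewrite -scalerAl -mpolyXD submK.
Qed.

Lemma skeleton_idealX c : skeleton_ideal k ('X_[c] : {mpoly K[n]}) <-> in_skeleton k c.
Proof.
rewrite skeleton_idealP msuppX; split=> [->//|h m]; first by rewrite inE.
by rewrite inE => /eqP ->.
Qed.

Lemma skeleton_idealZ (a : K) c : skeleton_ideal k (a *: 'X_[c] : {mpoly K[n]}) ->
  a != 0 -> in_skeleton k c.
Proof.
move=> /skeleton_idealP h a0; apply: h.
by rewrite msuppMCX // inE.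
Qed.

End SkeletonIdeal.

(** * Scalar data of minimal resolutions of I and of R/I *)

Section IdealResolution.

Variables (K : fieldType) (n k : nat) (F : mcomplex K n).
Hypothesis resF : minimal_resolution (skeleton_ideal k) zero_ideal F.

(** Prepending R through the augmentation turns a resolution of I into one of R/I, with homological
    degrees shifted by one. *)
Definition ext_rk i : nat := if i is j.+1 then rk F j else 1%N.

Definition ext_deg i : 'I_(ext_rk i) -> 'X_{1..n} :=
  match i with 0 => fun=> 0%MM | j.+1 => @deg _ _ F j end.
Arguments ext_deg i p : clear implicits.

Definition ext_dif i : 'M[{mpoly K[n]}]_(ext_rk i.+1, ext_rk i) :=
  match i with 0 => aug F | j.+1 => dif F j end.

Lemma ideal_kresolution : kresolution (in_skeleton k) ext_deg
  (fun i => coef_mx (ext_deg i.+1) (ext_deg i) (ext_dif i)).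
Proof.
have [[mgF mgA] [augL ontoL exA exF] minF] := resF.
have hM i : homogeneous_mx (ext_deg i.+1) (ext_deg i) (ext_dif i)
    (coef_mx (ext_deg i.+1) (ext_deg i) (ext_dif i)).
  apply: coef_mxP; case: i => [|i] p q m /=; last exact: mgF.
  by rewrite (ord1 q) => /mgA ->; rewrite addm0.
have ex i v : v *m ext_dif i = 0 <-> exists w : 'rV_(ext_rk i.+2), v = w *m ext_dif i.+1.
  case: i v => [|i] v; last exact: exF.
  rewrite -exA; split=> [->|h]; first by rewrite /zero_ideal mxE.
  by apply/matrixP => a b; rewrite !ord1 h mxE.
have exK i := exact_components (hM i.+1) (hM i) (ex i).
have augE p : aug F p 0 = coef_mx (@deg _ _ F 0) (fun _ : 'I_1 => 0%MM) (aug F) p 0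
    *: 'X_[deg p].
  by have [-> _] := hM 0%N p 0; rewrite subm0.
split.
- by exists (ord0 : 'I_1) => q; apply: ord1.
- by [].
- by move=> i p q; have [] := hM i p q.
- move=> i p q E; rewrite mxE; case: ifP => // _; rewrite E.
  have -> : (ext_deg _ q - ext_deg _ q = 0)%MM.
    by apply/mnmP => l; rewrite mnmBE subnn mnm0E.
  case: i p q E => [|i] p q /= E; last exact: minF.
  (* A constant term in the augmentation would put the monomial 1 into the ideal. *)
  apply/eqP/negPn/negP; rewrite -mcoeff_msupp (ord1 q) => h.
  by have /skeleton_idealP/(_ _ h) := augL p; rewrite in_skeleton0.
- by move=> i; case: (exK i).
- by move=> i; case: (exK i).
move=> c; split=> [/(skeleton_idealX K) /ontoL[v E]|[w wc wD]].
  exists (component (ext_deg 1) v c); first exact: component_supported.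
  have {}E : 'X_[c] = (v *m aug F) 0 0.
    by apply/eqP; rewrite -subr_eq0; apply/eqP.
  rewrite -(component_mulmx (hM 0%N)); apply: contra_neq (oner_neq0 K) => /rowP/(_ 0).
  move: E; rewrite !mxE /= => <-; rewrite subm0 mcoeffX eqxx (_ : (_ <= _)%MM) //.
  by apply/mnm_lepP => l; rewrite mnm0E.
have [p wp ap] : exists2 p, w 0 p != 0 &
    coef_mx (@deg _ _ F 0) (fun _ : 'I_1 => 0%MM) (aug F) p 0 != 0.
  apply/exists_inP; apply: contraNT wD => /exists_inPn h; apply/eqP/rowP => q.
  rewrite !mxE big1 // => p _; rewrite (ord1 q).
  have [->|wp] := eqVneq (w 0 p) 0; first by rewrite mul0r.
  by have := h p wp; rewrite negbK => /eqP E; rewrite [X in _ * X]E mulr0.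
apply: in_skeleton_le (wc p wp) _; have := augL p; rewrite augE => /skeleton_idealZ.
exact.
Qed.

End IdealResolution.

Section QuotientResolution.

Variables (K : fieldType) (n k : nat).
Let M := @skeleton_ideal K n k.

Lemma skeleton_ideal0 : M 0.
Proof. by apply/skeleton_idealP => m; rewrite msupp0. Qed.

Lemma skeleton_idealM f g : M f -> M (g * f).
Proof.
by case=> c ->; exists (fun A => g * c A); rewrite mulr_sumr; apply: eq_bigr => A _;
  rewrite mulrA.
Qed.

Lemma skeleton_ideal1 : ~ M 1.
Proof. by rewrite -mpolyX0 => /skeleton_idealX; rewrite in_skeleton0. Qed.

Variable F : mcomplex K n.
Hypothesis resF : minimal_resolution unit_ideal M F.

(** By exactness such a [v] comes from [F_1], and minimality leaves no constant term in its entries.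
    This is the tool for showing that [F_0] is R itself. *)
Let image_coef0 (v : 'rV_(rk F 0)) q : M ((v *m aug F) 0 0) -> (v 0 q)@_0%MM = 0.
Proof.
have [_ [_ _ exA _] minF] := resF.
move=> /exA[w ->]; rewrite mxE raddf_sum /= big1 // => p _.
by rewrite (rmorphM (mcoeff 0%MM)) /= minF mulr0.
Qed.

Let augE p : aug F p 0 = (aug F p 0)@_(deg p) *: 'X_[deg p].
Proof.
have [[_ mgA] _ _] := resF; apply/mpolyP => m; rewrite mcoeffZ mcoeffX.
have [/mgA ->|h] := boolP (m \in msupp (aug F p 0)); first by rewrite eqxx mulr1.
rewrite (memN_msupp_eq0 h); case: eqP => [->|]; rewrite ?mulr0 //.
by rewrite memN_msupp_eq0 ?mul0r.
Qed.

Let aug_neq0 p : aug F p 0 != 0.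
Proof.
apply/eqP => E; have := @image_coef0 (delta_mx 0 p) p.
rewrite -rowE mxE E mxE !eqxx mcoeff1 eqxx => /(_ skeleton_ideal0) /eqP.
by rewrite oner_eq0.
Qed.

Let deg_base p : deg (m := F) (i := 0) p = 0%MM.
Proof.
have [_ [_ onto _ _] _] := resF.
apply/eqP/negPn/negP => c0; set c := deg p in c0.
have [j cj] : exists j, c j != 0%N.
  apply/existsP; apply: contraNT c0 => /existsPn h; apply/eqP/mnmP => l.
  by rewrite mnm0E; apply/eqP; have := h l; rewrite negbK.
have jc : (U_(j) <= c)%MM by rewrite lep1mP.
have [v vM] := onto 'X_[c - U_(j)] I.
pose a := (aug F p 0)@_c.
(* If [x_j] divides the degree of [p], lifting the quotient monomial to [v] makes the basis vector
   congruent to a multiple of [x_j], although its coordinate at [p] has constant term 1. *)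
have := @image_coef0 (delta_mx 0 p - (a *: 'X_j) *: v) p.
rewrite mulmxBl -scalemxAl -rowE !mxE !eqxx augE -/a -/c.
set s := \sum_(i < _) _.
have -> : a *: 'X_[c] - a *: 'X_j * s = (a *: 'X_j) * ('X_[c - U_(j)] - s).
  by rewrite mulrBr; congr (_ - _); rewrite -scalerAl -mpolyXD addmC submK.
have -> : s = (v *m aug F) 0 0 by rewrite mxE.
move=> /(_ (skeleton_idealM _ vM)) /eqP.
rewrite mcoeffB mcoeff1 eqxx (rmorphM (mcoeff 0%MM)) /= mcoeffZ mcoeffX.
by rewrite mnm1_eq0 mulr0 mul0r subr0 oner_eq0.
Qed.

Let base_uniq p q : p = q :> 'I_(rk F 0).
Proof.
apply/eqP/negPn/negP => pq.
pose a x := (aug F x 0)@_0%MM.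
have aE x : aug F x 0 = (a x)%:MP.
  by rewrite augE deg_base mpolyX0 -/(a x) -mul_mpolyC mulr1.
(* Both basis vectors map to constants, and this combination maps to zero with the non-zero constant
   coefficient [a q] at [p]. *)
have := @image_coef0 ((a q)%:MP *: delta_mx 0 p - (a p)%:MP *: delta_mx 0 q) p.
rewrite mulmxBl -!scalemxAl -!rowE !mxE !eqxx /= !aE (negPf pq) !mulr0 mulr1 subr0.
rewrite [(a p)%:MP * _]mulrC subrr => /(_ skeleton_ideal0); rewrite mcoeffC eqxx mulr1.
by move=> aq; have := aug_neq0 q; rewrite aE aq mpolyC0 eqxx.
Qed.

Lemma quotient_kresolution : kresolution (in_skeleton k) (@deg _ _ F)
  (fun i => coef_mx (@deg _ _ F i.+1) (@deg _ _ F i) (dif F i)).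
Proof.
have [[mgF mgA] [_ ontoL exA exF] minF] := resF.
have hM i : homogeneous_mx (@deg _ _ F i.+1) (@deg _ _ F i) (dif F i)
    (coef_mx (@deg _ _ F i.+1) (@deg _ _ F i) (dif F i)).
  exact/coef_mxP/mgF.
have exK i := exact_components (hM i.+1) (hM i) (exF i).
have [q0 _] : exists q0 : 'I_(rk F 0), true.
  case E : (rk F 0) => [|r]; last by exists ord0.
  case: skeleton_ideal1; have [v] := ontoL 1 I.
  rewrite mxE big1 ?subr0 // => p _; have := ltn_ord p; by rewrite [X in (_ < X)%N]E.
have qE q : q = q0 by apply: base_uniq.
have augv (v : 'rV_(rk F 0)) : (v *m aug F) 0 0 = v 0 q0 * aug F q0 0.
  rewrite mxE (bigD1 q0) //= big1 ?addr0 // => q /negP[]; exact/eqP.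
split.
- by exists q0.
- exact: deg_base.
- by move=> i p q; have [] := hM i p q.
- move=> i p q E; rewrite mxE; case: ifP => // _; rewrite E.
  have -> : (deg q - deg q = 0)%MM by apply/mnmP => l; rewrite mnmBE subnn mnm0E.
  exact: minF.
- by move=> i; case: (exK i).
- by move=> i; case: (exK i).
move=> c; split=> [/(skeleton_idealX K) cM|[w wc wD]].
  have /exA[w E] : M (((\row_q 'X_[c] : 'rV_(rk F 0)) *m aug F) 0 0).
    by rewrite augv mxE mulrC; apply: skeleton_idealM.
  exists (component (@deg _ _ F 1) w c); first exact: component_supported.
  rewrite -(component_mulmx (hM 0%N)) -E; apply: contra_neq (oner_neq0 K) => /rowP/(_ q0).
  rewrite !mxE deg_base subm0 mcoeffX eqxx (_ : (_ <= _)%MM) //.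
  by apply/mnm_lepP => l; rewrite mnm0E.
set D0 := coef_mx _ _ _ in wD.
have /exA : exists w', homogeneous_row (@deg _ _ F 0) c (w *m D0) = w' *m dif F 0.
  exists (homogeneous_row (@deg _ _ F 1) c w).
  by rewrite (homogeneous_row_mulmx (hM 0%N)).
rewrite augv mxE augE deg_base subm0 mpolyX0 -scalerAl -scalerAr mulr1 scalerA.
move/skeleton_idealZ; apply; rewrite mulf_neq0 //; last first.
  by apply: contraNneq (aug_neq0 q0) => E; rewrite augE deg_base E scale0r.
by apply: contra_neq wD => E; apply/rowP => q; rewrite (qE q) E mxE.
Qed.

End QuotientResolution.

(** * From scalar data back to resolutions *)

Section ResolutionOfKResolution.

Variables (K : fieldType) (n k : nat) (rk : nat -> nat).
Variables (deg : forall i, 'I_(rk i) -> 'X_{1..n}).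
Variables (D : forall i, 'M[K]_(rk i.+1, rk i)).
Hypothesis resD : kresolution (in_skeleton k) deg D.

Let mdif i : 'M[{mpoly K[n]}]_(rk i.+1, rk i) :=
  \matrix_(p, q) (D i p q *: 'X_[deg p - deg q]).

Let hM i : homogeneous_mx (@deg i.+1) (@deg i) (mdif i) (D i).
Proof. by move=> p q; rewrite mxE; split=> //; apply: (kres_le resD). Qed.

Let mdif_deg i p q m : m \in msupp (mdif i p q) -> deg p = (m + deg q)%MM.
Proof.
rewrite mxE; have [->|D0] := eqVneq (D i p q) 0; first by rewrite scale0r msupp0.
by rewrite msuppMCX // inE => /eqP ->; rewrite submK // (kres_le resD).
Qed.

Let mdif_min i p q : (mdif i p q)@_0%MM = 0.
Proof.
rewrite mxE mcoeffZ mcoeffX; have [->|D0] := eqVneq (D i p q) 0; first by rewrite mul0r.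
have qp := kres_le resD D0; have [E|_] := eqVneq (deg p - deg q)%MM 0%MM.
  by case/eqP: D0; apply: (kres_min resD); rewrite -(submK qp) E add0m.
by rewrite mulr0.
Qed.

Let mdif_exact i (v : 'rV_(rk i.+1)) :
  v *m mdif i = 0 <-> exists w : 'rV_(rk i.+2), v = w *m mdif i.+1.
Proof.
exact (components_exact (@hM i.+1) (@hM i) (kres_cplx resD i)
  (@kres_exact _ _ _ _ _ _ resD i) v).
Qed.

Let image_base (q0 : 'I_(rk 0)) (v : 'rV_(rk 0)) : (forall q, q = q0) ->
  skeleton_ideal k (v 0 q0) <-> exists w : 'rV_(rk 1), v = w *m mdif 0.
Proof.
move=> qE; have cE c : component (@deg 0) v c 0 q0 = (v 0 q0)@_c.
  rewrite mxE (kres_deg0 resD) subm0 (_ : (_ <= _)%MM) //.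
  by apply/mnm_lepP => l; rewrite mnm0E.
split=> [/skeleton_idealP vI|[w E]]; last first.
  apply/skeleton_idealP => m; rewrite mcoeff_msupp -cE E (component_mulmx (@hM 0)) => h.
  apply/(kres_image resD); exists (component (@deg 1) w m).
    exact: component_supported.
  by apply: contraNneq h => ->; rewrite mxE.
apply: (image_components (@hM 0)) => c.
have [E|ne] := eqVneq (component (@deg 0) v c) 0.
  by exists 0; rewrite ?mul0mx // => p; rewrite mxE eqxx.
have vc : (v 0 q0)@_c != 0.
  by apply: contra_neq ne => E; apply/rowP => q; rewrite (qE q) cE E mxE.
rewrite -mcoeff_msupp in vc; have /(kres_image resD)[u uc uD] := vI c vc.
have u0 : (u *m D 0) 0 q0 != 0.
  by apply: contra_neq uD => E; apply/rowP => q; rewrite (qE q) E mxE.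
(* As [F_0] has rank one, rescaling one row with non-zero image reaches the prescribed component. *)
exists (((v 0 q0)@_c / (u *m D 0) 0 q0) *: u).
  by move=> p; rewrite mxE mulf_eq0 negb_or => /andP[_ /uc].
apply/rowP => q; rewrite (qE q) cE -scalemxAl [in RHS]mxE.
by rewrite divfK.
Qed.

Lemma exists_quotient_resolution :
  exists F, minimal_resolution unit_ideal (@skeleton_ideal K n k) F.
Proof.
have [q0 qE] := kres_base resD.
have augv (v : 'rV[{mpoly K[n]}]_(rk 0)) : (v *m (const_mx 1 : 'cV_(rk 0))) 0 0 = v 0 q0.
  rewrite mxE (bigD1 q0) //= big1 ?addr0 => [|q /negP[]]; last exact/eqP.
  by rewrite mxE mulr1.
exists (MComplex deg mdif (const_mx 1)); split; last exact: mdif_min.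
- split=> [i p q m|p m] /=; first exact: mdif_deg.
  by rewrite mxE msupp1 inE (kres_deg0 resD) => /eqP.
- split=> //= [f _|v].
    exists (const_mx f); rewrite augv mxE subrr; exact: skeleton_ideal0.
  by rewrite augv; apply: image_base.
Qed.

(** [F_0] is dropped, and the first differential, which has a single column, serves as
    augmentation. *)
Lemma exists_ideal_resolution :
  exists F, minimal_resolution (@skeleton_ideal K n k) zero_ideal F.
Proof.
have [q0 qE] := kres_base resD.
pose au : 'cV[{mpoly K[n]}]_(rk 1) := \col_p mdif 0 p q0.
have augv (v : 'rV[{mpoly K[n]}]_(rk 1)) : (v *m au) 0 0 = (v *m mdif 0) 0 q0.
  by rewrite !mxE; apply: eq_bigr => p _; rewrite mxE.
exists (@MComplex K n (fun i => rk i.+1) (fun i => @deg i.+1) (fun i => mdif i.+1) au).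
split=> [||i p q]; last exact: mdif_min.
  split=> [i p q m|p m] /=; first exact: mdif_deg.
  by rewrite mxE => /mdif_deg; rewrite (kres_deg0 resD) addm0.
split=> /= [p|f fM|v|i v]; last exact: mdif_exact.
- rewrite mxE.
  have /(image_base _ qE) : exists w : 'rV_(rk 1), row p (mdif 0) = w *m mdif 0.
    by exists (delta_mx 0 p); rewrite rowE.
  by rewrite mxE.
- have /(image_base (const_mx f) qE)[w E] :
      skeleton_ideal k ((const_mx f : 'rV_(rk 0)) 0 q0).
    by rewrite mxE.
  by exists w; rewrite augv -E mxE subrr.
rewrite -mdif_exact /zero_ideal augv; split=> [E|->]; last by rewrite mxE.
by apply/rowP => q; rewrite (qE q) E mxE.
Qed.

End ResolutionOfKResolution.

(** * Betti numbers of the chosen minimal resolutions *)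

Section SkeletonIdealBetti.

Variables (K : fieldType) (n k : nat).
Hypothesis kn : (k < n)%N.
Let M := @skeleton_ideal K n k.

Let exists_skeleton_kresolution : exists rk
  (deg : forall i, 'I_(rk i) -> 'X_{1..n}) (D : forall i, 'M[K]_(rk i.+1, rk i)),
  kresolution (in_skeleton k) deg D.
Proof.
apply: (@exists_kresolution K n n).
- exact: in_skeleton_le.
- exact: in_skeleton_trunc.
by rewrite in_skeleton0.
Qed.

(** Existence ensures that the choice made by [epsilon] is a minimal resolution; the counts obtained
    above hold for any such resolution. *)
Lemma minres_idealP : minimal_resolution M zero_ideal (minres M zero_ideal).
Proof.
have [rk [deg [D resD]]] := exists_skeleton_kresolution.
exact: epsilon_spec (exists_ideal_resolution resD).
Qed.

Lemma minres_quotientP : minimal_resolution unit_ideal M (minres unit_ideal M).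
Proof.
have [rk [deg [D resD]]] := exists_skeleton_kresolution.
exact: epsilon_spec (exists_quotient_resolution resD).
Qed.

Lemma mbetti_ideal_isolated (J : {set 'I_n}) i (b : 'X_{1..n}) :
    isolated k J -> weight k J = i.+1 -> perm_eq b (bdeg k J) ->
  mbetti_ideal M i b = isolated_betti k J.
Proof.
move=> iJ wJ pb.
have := betti_isolated kn (ideal_kresolution minres_idealP) i.+1 iJ pb.
by rewrite wJ eqxx mul1n.
Qed.

Lemma mbetti_ideal_neq0 i (b : 'X_{1..n}) : mbetti_ideal M i b != 0%N ->
  exists J : {set 'I_n}, [/\ isolated k J, weight k J = i.+1 & perm_eq b (bdeg k J)].
Proof.
move=> h; have := betti_neq0 kn (ideal_kresolution minres_idealP) (ltn0Sn i) h.
by exists (level_set n k (lev b)).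
Qed.

Lemma betti_ideal_sum i :
  betti_ideal M i = (\sum_(J in dual_iso1 n k i) beta1 J +
                     \sum_(J in dual_iso2 n k i) beta2 k J)%N.
Proof.
have := total_betti kn (ideal_kresolution minres_idealP) (ltn0Sn i).
by rewrite subn1.
Qed.

Lemma betti_quotient_sum i :
  betti_quotient M i.+1 = (\sum_(J in dual_iso1 n k i) beta1 J +
                           \sum_(J in dual_iso2 n k i) beta2 k J)%N.
Proof.
have := total_betti kn (quotient_kresolution minres_quotientP) (ltn0Sn i).
by rewrite subn1.
Qed.

End SkeletonIdealBetti.

Theorem proposition2p2 (K : fieldType) (n k i : nat)
    (hn : (0 < n)%N) (hk : (0 <= k <= n - 1)%N) (hi : (1 <= i <= n - 1)%N) :
  let M := @skeleton_ideal K n k in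
  [/\ (forall J : {set 'I_n}, J \in dual_iso1 n k (i - 1) ->
         #|J| = i /\ mbetti_ideal M (i - 1) (bdeg k J) = 1%N),
      (forall J : {set 'I_n}, J \in dual_iso2 n k (i - 1) ->
         (#|J| + elt J #|J| - (k + 1) = i)%N /\
         mbetti_ideal M (i - 1) (bdeg k J) =
           'C(elt J #|J| - elt J (#|J| - 1) - 1, k - elt J (#|J| - 1))),
      (forall b : 'X_{1..n},
         (forall (J : {set 'I_n}) (s : 'S_n),
            J \in dual_iso n k (i - 1) -> b = mnm_perm s (bdeg k J) ->
            mbetti_ideal M (i - 1) b = mbetti_ideal M (i - 1) (bdeg k J)) /\
         (~ (exists (J : {set 'I_n}) (s : 'S_n),
               J \in dual_iso n k (i - 1) /\ b = mnm_perm s (bdeg k J)) ->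
            mbetti_ideal M (i - 1) b = 0%N))
    & betti_ideal M (i - 1) = betti_quotient M i /\
      betti_quotient M i =
        (\sum_(J in dual_iso1 n k (i - 1)) beta1 J +
         \sum_(J in dual_iso2 n k (i - 1)) beta2 k J)%N].
Proof.
move=> M; have kn : (k < n)%N by lia.
have i0 : (0 < i)%N by case/andP: hi.
have iE : (i - 1).+1 = i by lia.
(* Both cases (i) and (ii), with the identity permutation, and the invariance in (iii) follow from
   this value. *)
have val J b (s : 'S_n) : J \in dual_iso n k (i - 1) -> b = mnm_perm s (bdeg k J) ->
    mbetti_ideal M (i - 1) b = isolated_betti k J.
  rewrite mem_dual_iso // => /andP[iJ /eqP wJ] E.
  apply: (mbetti_ideal_isolated K kn iJ); first by rewrite wJ iE.
  by apply/mnm_permP; exists s.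
have perm1 (J : {set 'I_n}) : bdeg k J = mnm_perm 1%g (bdeg k J).
  by apply/mnmP => l; rewrite mnmE perm1.
split.
- move=> J JI; have JI' : J \in dual_iso n k (i - 1) by rewrite inE JI.
  rewrite (val _ _ _ JI' (perm1 J)).
  move: JI; rewrite mem_dual_iso1 // => /and3P[iJ mk /eqP wJ].
  (* For type 1 the term [top J n - k] of the weight is 0 or 1, so the weight is the cardinality of
     [J]. *)
  rewrite isolated_betti1 //; split=> //; rewrite -(isolated_card kn iJ) -wJ /weight.
  by case: (ltnP k (top J n)) mk => /=; lia.
- move=> J JI; have JI' : J \in dual_iso n k (i - 1) by rewrite inE JI orbT.
  rewrite (val _ _ _ JI' (perm1 J)).
  move: JI; rewrite mem_dual_iso2 // => /and3P[iJ mk /eqP wJ].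
  rewrite isolated_betti2 //; split=> //; rewrite -top_last -wJ /weight.
  by have := isolated_card kn iJ; rewrite (ltnW mk) /=; lia.
- move=> b; split=> [J s JI E|nJ].
    by rewrite (val _ _ _ JI E) (val _ _ _ JI (perm1 J)).
  apply/eqP/negPn/negP => /(mbetti_ideal_neq0 kn)[J [iJ wJ /mnm_permP[s E]]].
  by case: nJ; exists J, s; rewrite mem_dual_iso // iJ wJ iE eqxx.
have -> : betti_quotient M i = betti_quotient M (i - 1).+1 by rewrite iE.
by rewrite betti_ideal_sum // betti_quotient_sum.
Qed.
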